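(* Let $W$ be a superspace with homogeneous basis $w_i$, $i\in R_W$. (a) $S^\bullet(S^2(W))=\bigoplus_\lambda W^\lambda$ as a $\mathfrak{gl}(W)$-module, where $\lambda$ runs over the partitions all of whose rows have even length, each appearing with multiplicity one. (b) For such $\lambda\vdash 2k$, let $t$ be the $\lambda$-tableau filled consecutively along the rows with $1,2,\dots,2k$ (first row first). Then the polynomials $\mathrm{Pf}_t(I)$, where $I$ runs over the $t$-semistandard sequences of length $2k$ with entries in $R_W$, form a basis of $W^\lambda\subset S^k(S^2(W))$.
   Context: $S^2(W)$ is the supersymmetric square; $x_{ij}$ denotes the image of $w_i\otimes w_j$ in $S^2(W)\subset S^\bullet(S^2(W))$. For a sequence $I$ of length $2k$, $X(I)=x_{i_1i_2}x_{i_3i_4}\cdots x_{i_{2k-1}i_{2k}}$. $\mathfrak S_{2k}$ permutes positions of sequences; $c(I,\sigma)=\pm1$ is defined by $x_{\sigma^{-1}I}=c(I,\sigma)x_I$ in the free supercommutative algebra on generators $x_i$ of parity $p(i)$. With $R_t,C_t$ the row and column stabilizers and $\varepsilon$ the sign, $\mathrm{Pf}_t(I)=\sum_{\tau\in C_t,\sigma\in R_t}\varepsilon(\tau)c(I,(\sigma\tau)^{-1})X(\sigma\tau I)$. $W^\lambda$ is the irreducible $\mathfrak{gl}(W)$-module paired with the Specht module $S^\lambda$ in $W^{\otimes|\lambda|}$ (zero if $\lambda$ is not in the $(p|q)$-hook, $\dim W=(p|q)$). A sequence is $t$-semistandard if, placing its $\alpha$-th entry in the cell containing $\alpha$, entries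 weakly increase along rows and down columns, even indices strictly increase down columns and odd indices strictly increase along rows (even indices precede odd ones). *)

(* Defs.v *)
From HB Require Import structures.
From mathcomp Require Import all_boot all_order all_algebra all_fingroup.
Set Implicit Arguments. Unset Strict Implicit. Unset Printing Implicit Defensive.
Import GRing.Theory.
Local Open Scope ring_scope.

(* Index set R_W = {0,..,p+q-1}; indices < p are even, indices >= p are odd,
   so that even indices precede odd ones in the total order. *)
Notation seqT p q n := {ffun 'I_n -> 'I_(p + q)}.
(* W^{(x) n} : coordinates w.r.t. the basis w_I = w_{i_1} (x) ... (x) w_{i_n}. *)
Notation tensorT F p q n := {ffun seqT p q n -> F^o}.
(* partitions of n, padded with zeros to length n *)
Notation ptn n := (n.-tuple 'I_n.+1).

Section Defs.
Variables (F : fieldType) (p q : nat).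
Local Notation m := (p + q).

Definition par (i : 'I_m) : bool := (p <= i)%N.

Section Deg.
Variable n : nat.

(* c(I, s): x_{s^-1 I} = c(I,s) x_I in the free supercommutative algebra
   on generators x_i of parity par i (Koszul sign). *)
Definition ksign (I : seqT p q n) (s : 'S_n) : F :=
  (-1) ^+ #|[set ab : 'I_n * 'I_n |
             [&& (ab.1 < ab.2)%N, (s ab.2 < s ab.1)%N, par (I (s ab.1)) & par (I (s ab.2))]]|.

Definition pact (s : 'S_n) (I : seqT p q n) : seqT p q n := [ffun a => I ((s^-1)%g a)].

Definition basisv (I : seqT p q n) : tensorT F p q n := [ffun J => (J == I)%:R].

Definition rho (s : 'S_n) (v : tensorT F p q n) : tensorT F p q n :=
  \sum_I v I *: (ksign I (s^-1)%g *: basisv (pact s I)).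

(* action of the elementary matrix E_{ab} of gl(W) on W^{(x) n} *)
Definition glact (a b : 'I_m) (v : tensorT F p q n) : tensorT F p q n :=
  \sum_I v I *: \sum_(r : 'I_n | I r == b)
     ((-1) ^+ ((par a (+) par b) * #|[set s : 'I_n | (s < r)%N && par (I s)]|)%N
       *: basisv [ffun s => if s == r then a else I s]).

Definition gl_stable (U : {vspace tensorT F p q n}) : Prop :=
  forall a b v, v \in U -> glact a b v \in U.

Definition gl_iso (U V : {vspace tensorT F p q n}) : Prop :=
  exists f : 'Hom(tensorT F p q n, tensorT F p q n),
    [/\ (f @: U)%VS = V, (U :&: lker f)%VS = 0%VS &
        forall a b v, v \in U -> f (glact a b v) = glact a b (f v)].

Definition lam (l : ptn n) (r : nat) : nat := nth 0%N (map val l) r.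
Definition is_part (l : ptn n) : bool :=
  sorted geq (map val l) && (sumn (map val l) == n).
Definition is_evpart (l : ptn n) : bool :=
  is_part l && all (fun x => ~~ odd x) (map val l).

(* the lambda-tableau t filled consecutively along the rows (0-based) *)
Definition cum (l : ptn n) (r : nat) : nat := \sum_(r' < r) lam l r'.
Definition row_of (l : ptn n) (a : 'I_n) : nat := #|[set r : 'I_n | (cum l r.+1 <= a)%N]|.
Definition col_of (l : ptn n) (a : 'I_n) : nat := (a - cum l (row_of l a))%N.

Definition Rt (l : ptn n) : {set 'S_n} :=
  [set s : 'S_n | [forall a, row_of l (s a) == row_of l a]].
Definition Ct (l : ptn n) : {set 'S_n} :=
  [set s : 'S_n | [forall a, col_of l (s a) == col_of l a]].

Definition semistd (l : ptn n) (I : seqT p q n) : bool :=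
  [forall a, forall b,
     ((row_of l a == row_of l b) && (col_of l a < col_of l b)%N) ==>
       ((I a <= I b)%N && ((I a == I b) ==> ~~ par (I a)))] &&
  [forall a, forall b,
     ((col_of l a == col_of l b) && (row_of l a < row_of l b)%N) ==>
       ((I a <= I b)%N && ((I a == I b) ==> par (I a)))].

(* Young symmetrizer image: W^lambda inside W^{(x) n}.
   (t * s)%g is the permutation x |-> s (t x), i.e. sigma o tau. *)
Definition young (l : ptn n) (v : tensorT F p q n) : tensorT F p q n :=
  \sum_(t in Ct l) \sum_(s in Rt l) ((-1) ^+ t) *: rho (t * s)%g v.
Definition Wlam (l : ptn n) : {vspace tensorT F p q n} :=
  (\sum_I <[young l (basisv I)]>)%VS.

End Deg.

Section Sym.
Variable k : nat.
Local Notation n := k.*2.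

(* stabilizer of the pairing {0,1},{2,3},... (hyperoctahedral group) *)
Definition Hk : {set 'S_n} :=
  [set h : 'S_n | [forall a : 'I_n, forall b : 'I_n, (a./2 == b./2) ==> ((h a)./2 == (h b)./2)]].

(* X(I) = x_{i1 i2} ... x_{i(2k-1) i(2k)}, realized in S^k(S^2 W) viewed
   (via super-symmetrization) inside W^{(x) 2k}. *)
Definition XX (I : seqT p q n) : tensorT F p q n := \sum_(h in Hk) rho h (basisv I).

Definition SkS2 : {vspace tensorT F p q n} := (\sum_I <[XX I]>)%VS.

Definition Pf (l : ptn n) (I : seqT p q n) : tensorT F p q n :=
  \sum_(t in Ct l) \sum_(s in Rt l)
     ((-1) ^+ t * ksign I ((t * s)^-1)%g) *: XX (pact (t * s)%g I).

End Sym.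
End Defs.

(* Main.v *)
Require Import Defs.
From HB Require Import structures.
From mathcomp Require Import all_boot all_order all_algebra all_fingroup.
From mathcomp Require Import zify.
Import Order.TTheory GRing.Theory Num.Theory.
Set Implicit Arguments. Unset Strict Implicit. Unset Printing Implicit Defensive.
Local Open Scope ring_scope.

(** Write e for the sum over the hyperoctahedral group, a and b for the row sum and the signed
    column sum of the tableau of shape l, all acting on tensors.  Then S^k(S^2 W) is the image
    of e, W^l is the image of ab, and Pf(I) = eab w_I, so the summand of type l is the image
    of eab.

    By von Neumann's lemma a g b is a multiple of ab for every permutation g, and a_m g b_l = 0
    for l <> m as soon as the sum of the row indices of m is at most that of l.  In particular
    a e a b = kappa ab with an integer kappa.  In the regular module over the integers
    <eab, eab> = |H| <b, aeab>, and the coefficient of eab at 1 is positive because h s t = 1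
    forces the column permutation t to be even when all rows of l are even; hence kappa <> 0.
    This makes e injective on W^l and, applying the a_m with the smallest sum of row indices,
    makes the summands independent.

    The elements e a b a e are therefore independent in the Hecke algebra e A e, whose
    dimension is the number of double cosets of H.  A double coset is determined by the cycle
    lengths of the union of two perfect matchings, that is, by an even partition; so these
    elements span e A e, e is a combination of them, and the summands span.

    Finally the vectors ab w_I with I semistandard form a basis of W^l: they span by
    straightening with Garnir relations, which increase the sum of (column index) * (entry),
    and they are independent by triangularity with respect to the sum of
    (row index) * (entry). *)

(** * Symmetrizers and shapes *)

Section Stab.
Variable n : nat.
Implicit Types (f : 'I_n -> nat) (s : 'S_n).

Definition stab f : {set 'S_n} := [set s : 'S_n | [forall a, f (s a) == f a]].

Lemma stabP f s : reflect (forall a, f (s a) = f a) (s \in stab f).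
Proof. by rewrite inE; apply: (iffP forallP) => h a; apply/eqP; rewrite ?h. Qed.

Lemma stab_group_set f : group_set (stab f).
Proof.
apply/group_setP; split; first by apply/stabP => a; rewrite perm1.
by move=> s t /stabP hs /stabP ht; apply/stabP => a; rewrite permM ht hs.
Qed.
Canonical stab_group f := Group (stab_group_set f).

Lemma tperm_stab f x y : f x = f y -> tperm x y \in stab f.
Proof. by move=> h; apply/stabP => a; case: tpermP => [->|->|]. Qed.

Lemma sum_perm (f : 'I_n -> nat) s : (\sum_x f (s x) = \sum_x f x)%N.
Proof. by rewrite [RHS](reindex_inj (@perm_inj _ s)). Qed.

End Stab.

Section SignedSums.
Variables (R : comNzRingType) (V : lmodType R) (n : nat).
Variable act : 'S_n -> {linear V -> V}.
Implicit Types (G : {group 'S_n}) (s t g : 'S_n) (v : V).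

(** A product of permutations applies its left factor first, so this is a left action for
    composition of maps. *)
Definition is_act :=
  (forall v, act 1%g v = v) /\ (forall s t v, act (s * t)%g v = act t (act s v)).

Definition symz (A : {set 'S_n}) v := \sum_(s in A) act s v.
Definition altz (A : {set 'S_n}) v := \sum_(s in A) (-1) ^+ s *: act s v.

Fact symz_is_linear A : linear (symz A).
Proof.
move=> c u v; rewrite /symz scaler_sumr -big_split; apply: eq_bigr => s _ /=.
by rewrite linearP.
Qed.
HB.instance Definition _ A := GRing.isLinear.Build R V V _ (symz A) (symz_is_linear A).

Fact altz_is_linear A : linear (altz A).
Proof.
move=> c u v; rewrite /altz scaler_sumr -big_split; apply: eq_bigr => s _ /=.
by rewrite linearP scalerDr !scalerA mulrC.
Qed.
HB.instance Definition _ A := GRing.isLinear.Build R V V _ (altz A) (altz_is_linear A).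

Hypothesis actP : is_act.

Lemma act1 v : act 1%g v = v. Proof. exact: (proj1 actP). Qed.
Lemma actM s t v : act (s * t)%g v = act t (act s v). Proof. exact: (proj2 actP). Qed.

Lemma act_symz G s v : s \in G -> act s (symz G v) = symz G v.
Proof.
move=> sG; rewrite /symz linear_sum /= [RHS](reindex_inj (mulIg s)) /=.
by apply: eq_big => [t|t _]; rewrite ?groupMr // actM.
Qed.

Lemma symz_act G s v : s \in G -> symz G (act s v) = symz G v.
Proof.
move=> sG; rewrite /symz [RHS](reindex_inj (mulgI s)) /=.
by apply: eq_big => [t|t _]; rewrite ?groupMl // actM.
Qed.

Lemma act_altz G s v : s \in G -> act s (altz G v) = (-1) ^+ s *: altz G v.
Proof.
move=> sG; rewrite /altz linear_sum /= [in RHS](reindex_inj (mulIg s)) /= scaler_sumr.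
apply: eq_big => [t|t _]; rewrite ?groupMr // actM linearZ /= scalerA.
by rewrite odd_permM signr_addb mulrCA -signr_addb addbb mulr1.
Qed.

Lemma altz_act G s v : s \in G -> altz G (act s v) = (-1) ^+ s *: altz G v.
Proof.
move=> sG; rewrite /altz [in RHS](reindex_inj (mulgI s)) /= scaler_sumr.
apply: eq_big => [t|t _]; rewrite ?groupMl // actM scalerA.
by rewrite odd_permM signr_addb mulrA -signr_addb addbb mul1r.
Qed.

Lemma symz_symz G v : symz G (symz G v) = #|G|%:R *: symz G v.
Proof.
rewrite {1}/symz (eq_bigr (fun _ => symz G v)) => [|s sG]; last exact: act_symz.
by rewrite sumr_const scaler_nat.
Qed.

Lemma altz_altz G v : altz G (altz G v) = #|G|%:R *: altz G v.
Proof.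
rewrite {1}/altz (eq_bigr (fun _ => altz G v)) => [|s sG].
  by rewrite sumr_const scaler_nat.
by rewrite act_altz // scalerA -signr_addb addbb scale1r.
Qed.

End SignedSums.

(** * Abstract Young diagrams and rearrangement of columns *)

Section Shape.
Variable n : nat.
Implicit Types (row col f : 'I_n -> nat).

(** A Young diagram given by coordinates: distinct cells forming an order ideal. Von Neumann's lemma
    and straightening use a tableau only through this. *)
Definition is_shape row col : Prop :=
  (forall x y, row x = row y -> col x = col y -> x = y) /\
  (forall x r c, (r <= row x)%N -> (c <= col x)%N -> exists y, row y = r /\ col y = c).

Lemma card_le_inj (A : {set 'I_n}) f m :
  {in A &, injective f} -> {in A, forall x, (f x < m)%N} -> (#|A| <= m)%N.
Proof.
move=> fI fm; rewrite cardE -(size_map f) -[m](size_iota 0).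
apply: uniq_leq_size.
  rewrite map_inj_in_uniq ?enum_uniq // => x y; rewrite !mem_enum; exact: fI.
by move=> i /mapP[x]; rewrite mem_enum mem_iota => /fm h ->.
Qed.

Lemma card_ge_surj (A : {set 'I_n}) f m :
  (forall i, (i < m)%N -> exists2 x, x \in A & f x = i) -> (m <= #|A|)%N.
Proof.
move=> fS; rewrite cardE -(size_map f) -[m](size_iota 0).
apply: uniq_leq_size; first exact: iota_uniq.
move=> i; rewrite mem_iota /= => /fS[x xA <-]; apply: map_f.
by rewrite mem_enum.
Qed.

Lemma row_rank row col y : is_shape row col ->
  row y = #|[set x | (col x == col y) && (row x < row y)%N]|.
Proof.
move=> [rcI rcD]; apply/eqP; rewrite eqn_leq; apply/andP; split.
  apply: (@card_ge_surj _ row) => i iy.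
  have [x [xi xc]] := rcD y i (col y) (ltnW iy) (leqnn _).
  by exists x; rewrite // inE xc eqxx xi.
apply: (@card_le_inj _ row) => [x x'|x]; rewrite !inE; last by case/andP.
by move=> /andP[/eqP cx _] /andP[/eqP cx' _] rx; apply: rcI; rewrite ?cx ?cx'.
Qed.

(* Both sides count unordered pairs of distinct points in a common column. *)
Lemma sum_rank_eq col f g :
  (forall x y, col x = col y -> f x = f y -> x = y) ->
  (forall x y, col x = col y -> g x = g y -> x = y) ->
  (\sum_y #|[set x | (col x == col y) && (f x < f y)]| =
   \sum_y #|[set x | (col x == col y) && (g x < g y)]|)%N.
Proof.
suff H h : (forall x y, col x = col y -> h x = h y -> x = y) ->
   ((\sum_y #|[set x | (col x == col y) && (h x < h y)]|).*2 =
    \sum_y \sum_x ((col x == col y) && (x != y)))%N.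
  move=> fI gI; apply: double_inj; rewrite !H //.
move=> hI.
have E : (\sum_y #|[set x | (col x == col y) && (h x < h y)]| =
          \sum_y \sum_x ((col x == col y) && (h x < h y)))%N.
  apply: eq_bigr => y _; rewrite -sum1_card big_mkcond /=.
  by apply: eq_bigr => x _; rewrite inE; case: ifP.
rewrite -addnn {1}E exchange_big /= E -big_split /=.
apply: eq_bigr => y _; rewrite -big_split /=; apply: eq_bigr => x _.
rewrite [col y == _]eq_sym; case: eqP => //= cxy.
have [->|nxy] := eqVneq x y; first by rewrite ltnn.
case: ltngtP => // hxy; case/eqP: nxy; apply: hI => //.
Qed.

(** In each column [f y] is at least the rank of [y] by [f]-value. The ranks have the same total as
    the row indices, so the bound on the sum forces [f] to equal the rank. *)
Lemma column_rearrange row col f : is_shape row col ->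
  (forall x y, col x = col y -> f x = f y -> x = y) ->
  (\sum_x f x <= \sum_x row x)%N ->
  exists2 t : 'S_n, t \in stab col & forall y, row (t y) = f y.
Proof.
move=> sh fI le; have [rcI rcD] := sh.
have rI x y : col x = col y -> row x = row y -> x = y by move=> h1 h2; exact: rcI.
pose rk y := #|[set x | (col x == col y) && (f x < f y)%N]|.
have rkf y : (rk y <= f y)%N.
  apply: (@card_le_inj _ f) => [x x'|x]; rewrite !inE; last by case/andP.
  by move=> /andP[/eqP cx _] /andP[/eqP cx' _]; apply: fI; rewrite cx.
have sumrk : (\sum_y rk y = \sum_y row y)%N.
  rewrite (sum_rank_eq fI rI); apply: eq_bigr => y _; by rewrite -row_rank.
have frk y : f y = rk y.
  apply/eqP; rewrite eqn_leq rkf andbT leqNgt; apply/negP => lt.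
  move: le; rewrite -sumrk leqNgt => /negP; apply.
  rewrite (bigD1 y) //= [X in (_ < X)%N](bigD1 y) //= -addSn leq_add //.
  by apply: leq_sum => i _.
(* If the column stopped before row [f y] it would have at most [f y] cells; but [f y] counts its
   cells of strictly smaller [f]-value, which omits [y]. *)
have ex y : exists z, (row z == f y) && (col z == col y).
  have [x [cx rx]] : exists x, col x = col y /\ (f y <= row x)%N.
    case: (pickP [pred x | (col x == col y) && (f y <= row x)%N]) => [x /andP[/eqP]|no].
      by exists x.
    have : (#|[set x | col x == col y]| <= f y)%N.
      apply: (@card_le_inj _ row) => [x x'|x]; rewrite !inE.
        by move=> /eqP cx /eqP cx'; apply: rI; rewrite cx.
      by move=> cx; move: (no x); rewrite /= cx /= leqNgt => /negbFE.
    rewrite leqNgt => /negP[]; rewrite frk; apply: proper_card.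
    apply/properP; split; first by apply/subsetP => x; rewrite !inE => /andP[].
    by exists y; rewrite !inE ?eqxx // ltnn andbF.
  have [z [rz cz]] := rcD x (f y) (col x) rx (leqnn _).
  by exists z; rewrite rz cz cx !eqxx.
pose t0 y := xchoose (ex y).
have t0r y : row (t0 y) = f y by have /andP[/eqP] := xchooseP (ex y).
have t0c y : col (t0 y) = col y by have /andP[_ /eqP] := xchooseP (ex y).
have t0I : injective t0.
  by move=> x y e; apply: fI; [rewrite -(t0c x) -(t0c y) e|rewrite -(t0r x) -(t0r y) e].
exists (perm t0I); first by apply/stabP => y; rewrite permE.
by move=> y; rewrite permE.
Qed.

End Shape.

(** * Von Neumann's lemma for a row sum and a signed column sum *)

Section VonNeumann.
Variables (R : comNzRingType) (V : lmodType R) (n : nat).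
Variable act : 'S_n -> {linear V -> V}.
Hypotheses (actP : is_act act) (tf2 : forall v : V, v + v = 0 -> v = 0).
Local Notation symz := (symz act).
Local Notation altz := (altz act).
Implicit Types (s t g : 'S_n) (v : V) (row col : 'I_n -> nat).

(** The row sum absorbs the transposition of [x] and [y]; moved across [g] it becomes a
    transposition inside a column and yields a sign. The value equals its own opposite. *)
Lemma symz_altz_eq0 row col g v x y : x != y -> row x = row y ->
  col ((g^-1)%g x) = col ((g^-1)%g y) -> symz (stab row) (act g (altz (stab col) v)) = 0.
Proof.
move=> nxy rxy cxy; apply: tf2.
rewrite -[X in X + _](symz_act actP _ (tperm_stab rxy)) -actM //.
have -> : (g * tperm x y = tperm ((g^-1)%g x) ((g^-1)%g y) * g)%g.
  rewrite -(tpermJ x y (g^-1)%g) conjgE invgK -!mulgA mulVg mulg1 //.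
rewrite actM // act_altz //=; last exact: tperm_stab.
rewrite odd_tperm (inj_eq perm_inj) nxy expr1 scaleN1r !linearN /= addNr //.
Qed.

(** Without a pair as in [symz_altz_eq0], the function [row (g y)] is injective on each column of
    the second shape, so [column_rearrange] applies. *)
Lemma symz_altz_dichotomy row row' col' g : is_shape row' col' ->
  (\sum_x row x <= \sum_x row' x)%N ->
  (forall v, symz (stab row) (act g (altz (stab col') v)) = 0) \/
  exists2 t, t \in stab col' & forall x, row' (t ((g^-1)%g x)) = row x.
Proof.
move=> sh le.
case: (boolP [exists x, exists y, [&& x != y, row x == row y &
   col' ((g^-1)%g x) == col' ((g^-1)%g y)]]).
  case/existsP=> x /existsP[y /and3P[nxy /eqP rxy /eqP cxy]]; left => v.
  exact: symz_altz_eq0 nxy rxy cxy.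
rewrite negb_exists => /forallP no; right.
have [||t tc tr] := @column_rearrange n row' col' (fun y => row (g y)) sh.
- move=> x y cxy rxy; apply: (@perm_inj _ g); apply/eqP; apply: contraT => nxy.
  move: (no (g x)); rewrite negb_exists => /forallP/(_ (g y)).
  by rewrite nxy rxy !permK cxy !eqxx.
- by rewrite sum_perm.
by exists t => // x; rewrite tr permKV.
Qed.

(** The sign of the column factor if [g] is a column permutation followed by a row permutation, and
    0 otherwise. For a shape this factorization is unique, since only the identity preserves all
    rows and columns. *)
Definition eps row col g : int :=
  if [pick t in stab col | (g^-1 * t)%g \in stab row] is Some t then (-1) ^+ t else 0.

Lemma symz_altz_eps row col g v : is_shape row col ->
  symz (stab row) (act g (altz (stab col) v)) =
  (eps row col g)%:~R *: symz (stab row) (altz (stab col) v).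
Proof.
move=> sh; rewrite /eps; case: pickP => [t /andP[tc sr]|no].
  have -> : g = (t * (g^-1 * t)^-1)%g by rewrite invMg invgK mulKVg.
  rewrite actM // symz_act ?groupV // act_altz // linearZ /=.
  by rewrite rmorphXn /= rmorphN1.
rewrite mulr0z scale0r.
have [//|[t tc tr]] := @symz_altz_dichotomy row row col g sh (leqnn _).
move: (no t); rewrite tc /= => /negP[]; apply/stabP => x.
by rewrite permM tr.
Qed.

Definition kappa (row col : 'I_n -> nat) (H : {set 'S_n}) : int :=
  \sum_(h in H) \sum_(s in stab row) eps row col (s * h)%g.

(** Von Neumann's lemma applies to each product [s * h]. The integer [kappa] does not depend on the
    module, so its nonvanishing can be tested in the regular one. *)
Lemma symz_sandwich row col (H : {set 'S_n}) v : is_shape row col ->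
  symz (stab row) (symz H (symz (stab row) (altz (stab col) v))) =
  (kappa row col H)%:~R *: symz (stab row) (altz (stab col) v).
Proof.
move=> sh; set w := altz _ _.
have -> : symz H (symz (stab row) w) = \sum_(h in H) \sum_(s in stab row) act (s * h)%g w.
  apply: eq_bigr => h _; rewrite linear_sum; apply: eq_bigr => s _ /=.
  by rewrite actM.
rewrite linear_sum /kappa [X in X *: _](raddf_sum (intmul (1 : R))) scaler_suml.
apply: eq_bigr => h _.
rewrite linear_sum /= [X in X *: _](raddf_sum (intmul (1 : R))) scaler_suml.
by apply: eq_bigr => s _; exact: symz_altz_eps.
Qed.

End VonNeumann.

(** * The regular module and positivity *)

Section RegularModule.
Variables (R : comNzRingType) (n : nat).
Local Notation regT := {ffun 'S_n -> R^o}.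

Definition reg_act (s : 'S_n) (x : regT) : regT := [ffun g => x (g * s^-1)%g].

Fact reg_act_is_linear s : linear (reg_act s).
Proof. by move=> c x y; apply/ffunP => g; rewrite !ffunE. Qed.
HB.instance Definition _ s :=
  GRing.isLinear.Build R regT regT _ (reg_act s) (reg_act_is_linear s).

Definition regL (s : 'S_n) : {linear regT -> regT} := reg_act s.

Lemma regL_act : is_act regL.
Proof.
split=> [x|s t x]; apply/ffunP => g; rewrite !ffunE ?invg1 ?mulg1 //.
by rewrite invMg mulgA.
Qed.

Definition reg_delta : regT := [ffun g => (g == 1%g)%:R].

Lemma regL_delta s g : regL s reg_delta g = (g == s)%:R.
Proof. by rewrite !ffunE -(inj_eq (mulIg s)) mulgKV mul1g. Qed.

Definition dotr (x y : regT) : R := \sum_g x g * y g.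

Lemma dotrC x y : dotr x y = dotr y x.
Proof. by apply: eq_bigr => g _; rewrite mulrC. Qed.

Lemma dotrZr c x y : dotr x (c *: y) = c * dotr x y.
Proof. by rewrite /dotr mulr_sumr; apply: eq_bigr => g _; rewrite ffunE mulrCA. Qed.

Lemma dotr_sumr (I : finType) (P : pred I) x (y : I -> regT) :
  dotr x (\sum_(i | P i) y i) = \sum_(i | P i) dotr x (y i).
Proof.
rewrite /dotr exchange_big; apply: eq_bigr => g _ /=.
by rewrite sum_ffunE mulr_sumr.
Qed.

Lemma dotr_act s x y : dotr (regL s x) y = dotr x (regL s^-1%g y).
Proof.
rewrite /dotr (reindex_inj (mulIg s)); apply: eq_bigr => g _ /=.
by rewrite !ffunE mulgK invgK.
Qed.

(** The adjoint of a translation is the inverse translation, and [G] is closed under inversion. *)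
Lemma dotr_symz (G : {group 'S_n}) x y :
  dotr (symz regL G x) y = dotr x (symz regL G y).
Proof.
rewrite dotrC !dotr_sumr [RHS](reindex_inj invg_inj) /=.
apply: eq_big => [s|s _]; first by rewrite groupV.
by rewrite dotrC dotr_act.
Qed.

Lemma dotr_altz (G : {group 'S_n}) x y :
  dotr (altz regL G x) y = dotr x (altz regL G y).
Proof.
rewrite dotrC !dotr_sumr [RHS](reindex_inj invg_inj) /=.
apply: eq_big => [s|s _]; first by rewrite groupV.
by rewrite !dotrZr dotrC dotr_act odd_permV.
Qed.

End RegularModule.

Arguments reg_delta {R n}.
Arguments regL {R n}.

Section IntegerLift.
Variables (R : comNzRingType) (n : nat).

(** Positivity is proved over the integers, where a vanishing sum of squares has vanishing terms;
    this map transfers coefficients to other rings. *)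
Definition reg_intr (x : {ffun 'S_n -> int^o}) : {ffun 'S_n -> R^o} :=
  [ffun g => (x g)%:~R].

Lemma reg_intr_delta : reg_intr reg_delta = reg_delta.
Proof. by apply/ffunP => g; rewrite !ffunE; case: eqP. Qed.

Lemma reg_intr_symz A x : reg_intr (symz regL A x) = symz regL A (reg_intr x).
Proof.
apply/ffunP => g; rewrite !ffunE !sum_ffunE (raddf_sum (intmul (1 : R))).
by apply: eq_bigr => s _; rewrite !ffunE.
Qed.

Lemma reg_intr_altz A x : reg_intr (altz regL A x) = altz regL A (reg_intr x).
Proof.
apply/ffunP => g; rewrite !ffunE !sum_ffunE (raddf_sum (intmul (1 : R))).
apply: eq_bigr => s _; rewrite !ffunE.
apply: (etrans (intrM _ _ _)); congr (_ * _).
by rewrite rmorphXn /= rmorphN1.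
Qed.

End IntegerLift.

Lemma sumr_gt0_at (n : nat) (A : {group 'S_n}) (f : 'S_n -> int) :
  (forall s, s \in A -> 0 <= f s) -> 0 < f 1%g -> 0 < \sum_(s in A) f s.
Proof.
move=> f0 f1; rewrite (bigD1 1%g) //=; apply: ltr_wpDr => //.
by apply: sumr_ge0 => s /andP[sA _]; exact: f0.
Qed.

Section Positivity.
Variables (n : nat) (row col : 'I_n -> nat) (H : {group 'S_n}).
Hypothesis sh : is_shape row col.
Hypothesis even_col : forall s t h, s \in stab row -> t \in stab col -> h \in H ->
  (t * s * h = 1)%g -> odd_perm t = false.

Local Notation e := (symz regL H).
Local Notation a := (symz regL (stab row)).
Local Notation b := (altz regL (stab col)).
Local Notation d := (@reg_delta int n).

Lemma dotr_self_eq0 (x : {ffun 'S_n -> int^o}) : dotr x x = 0 -> x = 0.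
Proof.
move=> h; apply/ffunP => g; rewrite ffunE.
have := psumr_eq0P (P := predT) (F := fun g => x g * x g : int) (fun g _ => sqr_ge0 (x g)) h.
move/(_ g isT)/eqP.
by rewrite mulf_eq0 orbb => /eqP.
Qed.

(** The coefficient at 1 sums the signs of [t] over the triples with [t * s * h = 1]. By [even_col]
    all these signs are 1, and the trivial triple occurs. *)
Lemma eab_at1_gt0 : 0 < (e (a (b d)) : {ffun _ -> _}) 1%g :> int.
Proof.
have -> : e (a (b d)) = \sum_(h in H) \sum_(s in stab row) \sum_(t in stab col)
    (-1) ^+ t *: regL (t * s * h)%g d.
  apply: eq_bigr => h _; rewrite linear_sum; apply: eq_bigr => s _ /=.
  rewrite !linear_sum; apply: eq_bigr => t _ /=.
  by rewrite !linearZ /= !(actM (regL_act _ _)).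
rewrite sum_ffunE.
have E h s : (\sum_(t in stab col) (-1) ^+ t *: regL (t * s * h)%g d) 1%g =
  \sum_(t in stab col) (-1) ^+ t * (1%g == t * s * h)%g%:R :> int.
  by rewrite sum_ffunE; apply: eq_bigr => t _; rewrite ffunE regL_delta.
have F h s t : h \in H -> s \in stab row -> t \in stab col ->
   0 <= (-1) ^+ t * (1%g == t * s * h)%g%:R :> int.
  move=> hH sR tC; case: eqP => [/esym/(even_col sR tC hH) ->|_]; by rewrite ?mulr0.
have G h s : h \in H -> s \in stab row ->
   0 <= \sum_(t in stab col) (-1) ^+ t * (1%g == t * s * h)%g%:R :> int.
  by move=> hH sR; apply: sumr_ge0 => t; apply: F.
apply: sumr_gt0_at => [h hH|]; rewrite sum_ffunE.
  by apply: sumr_ge0 => s sR; rewrite E; apply: G.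
apply: sumr_gt0_at => [s sR|]; rewrite E ?G //.
apply: sumr_gt0_at => [t tR|]; first exact: F.
by rewrite !mulg1 eqxx odd_perm1.
Qed.

(** Pairing with [d] reads the coefficient at 1, and self-adjointness of the three sums reverses
    their order. *)
Lemma bae_at1_gt0 : 0 < (b (a (e d)) : {ffun _ -> _}) 1%g :> int.
Proof.
have -> : b (a (e d)) 1%g = dotr (b (a (e d))) d.
  rewrite /dotr (bigD1 1%g) //= big1 ?addr0 => [|g /negPf g1]; rewrite ffunE ?eqxx ?mulr1 //.
  by rewrite g1 mulr0.
rewrite dotr_altz dotr_symz dotr_symz dotrC.
rewrite /dotr (bigD1 1%g) //= big1 ?addr0 => [|g /negPf g1]; rewrite [d _]ffunE ?eqxx ?mulr1 ?g1 ?mulr0 //.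
exact: eab_at1_gt0.
Qed.

Lemma int_tf2 (v : {ffun 'S_n -> int^o}) : v + v = 0 -> v = 0.
Proof.
move=> /ffunP h; apply/ffunP => g; move: (h g); rewrite !ffunE.
by move/eqP; rewrite -mulr2n mulrn_eq0 => /eqP.
Qed.

Lemma kappa_neq0 : kappa row col H != 0.
Proof.
apply/eqP => k0.
have z : a (e (a (b d))) = 0.
  by rewrite (symz_sandwich (regL_act _ _) int_tf2) // k0 mulr0z scale0r.
have /dotr_self_eq0 u0 : dotr (e (a (b d))) (e (a (b d))) = 0.
  rewrite dotr_symz (symz_symz (regL_act _ _)) dotrZr dotr_symz z.
  by rewrite /dotr big1 ?mulr0 // => g _; rewrite [X in _ * X]ffunE mulr0.
by have := eab_at1_gt0; rewrite u0 ffunE.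
Qed.

(** Multiplied by the order of the column group, the coefficient at 1 is the square norm of
    [b (a (e d))], which is nonzero by [bae_at1_gt0]. *)
Lemma eabae_at1_neq0 : (e (a (b (a (e d)))) : {ffun _ -> _}) 1%g != 0 :> int.
Proof.
have -> : e (a (b (a (e d)))) 1%g = dotr (e (a (b (a (e d))))) d.
  rewrite /dotr (bigD1 1%g) //= big1 ?addr0 => [|g /negPf g1]; rewrite [d _]ffunE ?eqxx ?mulr1 //.
  by rewrite g1 mulr0.
rewrite 2!dotr_symz.
apply/eqP => z0.
have /dotr_self_eq0 u0 : dotr (b (a (e d))) (b (a (e d))) = 0.
  by rewrite dotr_altz (altz_altz (regL_act _ _)) dotrZr dotrC z0 mulr0.
by have := bae_at1_gt0; rewrite u0 ffunE.
Qed.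

End Positivity.

(** * Orthogonality and independence of the shapes *)

Section Separation.
Variables (R : comNzRingType) (V : lmodType R) (n : nat).
Variable act : 'S_n -> {linear V -> V}.
Hypothesis actP : is_act act.
Hypothesis tf : forall (z : int) (v : V), z != 0 -> z%:~R *: v = 0 -> v = 0.
Variables (L : finType) (P : pred L) (row col : L -> 'I_n -> nat) (H : {group 'S_n}).
Hypothesis sh : forall l, P l -> is_shape (row l) (col l).
Hypothesis rowI : forall l m (s : 'S_n), P l -> P m ->
  (forall x, row l (s x) = row m x) -> l = m.
Hypothesis k0 : forall l, P l -> kappa (row l) (col l) H != 0.

Local Notation e := (symz act H).
Local Notation a l := (symz act (stab (row l))).
Local Notation b l := (altz act (stab (col l))).

Lemma torsion2_free (v : V) : v + v = 0 -> v = 0.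
Proof.
move=> h; apply: (tf (z := 2)) => //.
by rewrite -[2%:~R]/(1 + 1) scalerDl scale1r.
Qed.

(** After expanding e and the row sum of [m], the dichotomy applies to each [s * h]. Its second
    alternative would match the rows of the two shapes by a permutation, forcing [l = m]. *)
Lemma symz_altz_distinct l m v : P l -> P m -> l != m ->
  (\sum_x row l x <= \sum_x row m x)%N -> a l (e (a m (b m v))) = 0.
Proof.
move=> Pl Pm nlm le; rewrite linear_sum big1 // => h _.
rewrite !linear_sum big1 //= => s _.
rewrite -actM //.
have [->//|[t tc tr]] := symz_altz_dichotomy actP torsion2_free (s * h)%g (sh Pm) le.
case/eqP: nlm; symmetry; apply: (rowI (s := ((s * h)^-1 * t)%g)) => // x.
by rewrite permM.
Qed.

(* Apply the row symmetrizer of the shape with the smallest sum of row indices. *)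
Lemma pf_independent (v : L -> V) :
  \sum_(l | P l) e (a l (b l (v l))) = 0 -> forall l, P l -> a l (b l (v l)) = 0.
Proof.
move=> s0 l; have [N] := ubnP (\sum_x row l x)%N; elim: N l => // N IH l ltN Pl.
apply: (tf (k0 Pl)); rewrite -(symz_sandwich actP torsion2_free _ _ (sh Pl)).
have := congr1 (a l) s0; rewrite linear0 linear_sum (bigD1 l) //= big1 ?addr0 //.
(* Shapes whose total is at least that of [l] are killed by [a l]; those with a smaller total vanish
   by induction. *)
move=> m /andP[Pm nml]; have [le|lt] := leqP (\sum_x row l x) (\sum_x row m x).
  by apply: symz_altz_distinct; rewrite // eq_sym.
by rewrite IH ?linear0 //; apply: leq_trans lt ltN.
Qed.

Lemma pf_injective l v : P l -> e (a l (b l v)) = 0 -> a l (b l v) = 0.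
Proof.
move=> Pl e0; apply: (tf (k0 Pl)).
by rewrite -(symz_sandwich actP torsion2_free _ _ (sh Pl)) e0 linear0.
Qed.

End Separation.

(** * Pairs of fixed-point-free involutions *)

Section TwoInvolutions.
Variables (T : finType) (x0 : T) (u0 u : T -> T).
Hypotheses (u0K : involutive u0) (uK : involutive u).
Hypotheses (u0N : forall x, u0 x != x) (uN : forall x, u x != x).

Local Notation turn := (fun x => u (u0 x)).

(** A cycle of the union of the two matchings: [u0] leads from even positions to the next one, [u]
    from odd positions, and from the last one back to the start. *)
Definition alternating (b : seq T) : Prop :=
  [/\ (0 < size b)%N, ~~ odd (size b),
      forall i, (i < size b)%N -> ~~ odd i -> nth x0 b i.+1 = u0 (nth x0 b i) &
      forall i, (i < size b)%N -> odd i ->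
        nth x0 b (if i.+1 == size b then 0%N else i.+1) = u (nth x0 b i)].

Fixpoint zigzag m x := if m is m'.+1 then x :: u0 x :: zigzag m' (turn x) else [::].

Lemma size_zigzag m x : size (zigzag m x) = m.*2.
Proof. by elim: m x => //= m IH x; rewrite IH doubleS. Qed.

Lemma nth_zigzag m x i : (i < m.*2)%N -> nth x0 (zigzag m x) i =
  (if odd i then u0 (iter i./2 turn x) else iter i./2 turn x).
Proof.
elim: m x i => //= m IH x [|[|i]] //= lt; rewrite IH; last by move: lt; rewrite doubleS.
by rewrite negbK -!iterSr.
Qed.

Lemma turn_inj : injective turn.
Proof. exact: inj_comp (inv_inj uK) (inv_inj u0K). Qed.

(* Peeling one turn from each end reduces the claim to the fact that neither
   involution has a fixed point. *)
Lemma iter_turn_neq i x : iter i turn x != u0 x.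
Proof.
have [N] := ubnP i; elim: N i x => // N IH [|[|i]] x ltN.
- by rewrite eq_sym.
- by rewrite /= uN.
rewrite iterS; apply/negP => /eqP h.
have := IH i (turn x) (ltnW ltN); rewrite -iterSr iterS => /negP; apply.
by apply/eqP; apply: turn_inj; rewrite /= u0K uK -h iterS.
Qed.

Lemma iter_turn_neq2 i j x : iter i turn x != u0 (iter j turn x).
Proof.
case: (leqP j i) => h; first by rewrite -(subnK h) iterD iter_turn_neq.
rewrite -(subnK (ltnW h)) iterD eq_sym -(inj_eq (inv_inj u0K)) u0K.
exact: iter_turn_neq.
Qed.

(** Even positions run through the [turn]-orbit of [x], odd ones through its image under [u0]; these
    are disjoint by [iter_turn_neq2]. *)
Lemma uniq_zigzag x : uniq (zigzag (fingraph.order turn x) x).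
Proof.
have oi i j : (i < fingraph.order turn x)%N -> (j < fingraph.order turn x)%N ->
    (iter i turn x == iter j turn x) = (i == j).
  move=> hi hj; have := nth_uniq x (s := fingraph.orbit turn x) (i := i) (j := j).
  by rewrite size_orbit orbit_uniq /fingraph.orbit !nth_traject // => ->.
apply/(uniqP x0) => i j; rewrite !inE !size_zigzag => hi hj.
rewrite !nth_zigzag // => /eqP.
have hi2 : (i./2 < fingraph.order turn x)%N by rewrite -ltn_double; lia.
have hj2 : (j./2 < fingraph.order turn x)%N by rewrite -ltn_double; lia.
case: ifP => oi'; case: ifP => oj.
- by rewrite (inj_eq (inv_inj u0K)) oi //; lia.
- by rewrite eq_sym (negPf (iter_turn_neq2 _ _ _)).
- by rewrite (negPf (iter_turn_neq2 _ _ _)).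
- by rewrite oi //; lia.
Qed.

Lemma alternating_zigzag x : alternating (zigzag (fingraph.order turn x) x).
Proof.
have o0 := fingraph.order_gt0 turn x.
split=> [||i|i]; rewrite size_zigzag ?double_gt0 ?odd_double // => hi oi.
  have hi' : (i.+1 < (fingraph.order turn x).*2)%N by lia.
  by rewrite !nth_zigzag //= oi (negPf oi) uphalf_half (negPf oi).
rewrite (nth_zigzag x hi) oi; case: eqP => [e|ne].
  rewrite nth_zigzag //=; last by lia.
  have -> : i./2 = (fingraph.order turn x).-1 by lia.
  by rewrite -[LHS](iter_order turn_inj) -[in LHS](prednK o0) iterS.
rewrite nth_zigzag /= ?oi /=; last by lia.
by rewrite uphalf_half oi add1n iterS.
Qed.

Lemma zigzag_closed x y : (y \in zigzag (fingraph.order turn x) x) ->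
  (u0 y \in zigzag (fingraph.order turn x) x) && (u y \in zigzag (fingraph.order turn x) x).
Proof.
have [p1 p2 p3 p4] := alternating_zigzag x.
move: (zigzag _ _) p1 p2 p3 p4 => b p1 p2 p3 p4.
move=> yb; have [i hi e] : exists2 i, (i < size b)%N & nth x0 b i = y.
  by exists (index y b); rewrite ?index_mem ?nth_index.
case: (boolP (odd i)) => oi.
  have h0 : (i.-1 < size b)%N by lia.
  have := p3 _ h0; rewrite prednK ?e; last by lia.
  move=> /(_ ltac:(lia)) ey; apply/andP; split; first by rewrite ey u0K mem_nth.
  rewrite -e -p4 // mem_nth //; by case: eqP => // /eqP ne; rewrite ltn_neqAle ne.
rewrite -{1}e -p3 // mem_nth /=; last by lia.
have [i0|i0] := posnP i.
  have := p4 (size b).-1 ltac:(lia) ltac:(lia); rewrite prednK // eqxx -i0 e => ->.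
  by rewrite uK mem_nth // ltn_predL.
have := p4 i.-1 ltac:(lia) ltac:(lia); rewrite prednK //.
rewrite ltn_eqF // e => ->.
by rewrite uK mem_nth // (leq_ltn_trans (leq_pred i)).
Qed.

(** One cycle is split off; both involutions preserve it, hence also its complement in [S], to which
    induction applies. *)
Lemma alternating_cover (S : {set T}) :
  (forall x, x \in S -> (u0 x \in S) && (u x \in S)) ->
  exists ss, [/\ forall b, b \in ss -> alternating b, uniq (flatten ss) & flatten ss =i S].
Proof.
have [N] := ubnP #|S|; elim: N S => // N IH S ltN Sc.
have [->|[x xS]] := set_0Vmem S; first by exists [::]; split=> // y; rewrite inE.
set b := zigzag (fingraph.order turn x) x.
have bS y : y \in b -> y \in S.
  suff aux m z : z \in S -> y \in zigzag m z -> y \in S by exact: aux.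
  elim: m z => [|m IHm] z zS; first by rewrite in_nil.
  have /andP[z1 z2] := Sc _ zS; rewrite !inE => /or3P[/eqP->|/eqP->|] //.
  by apply: IHm; have /andP[] := Sc _ z1.
have xb : x \in b by rewrite /b -(prednK (fingraph.order_gt0 turn x)) /= mem_head.
have [||ss [s1 s2 s3]] := IH (S :\: [set y in b]).
- rewrite ltnS in ltN; apply: leq_trans (proper_card _) ltN; apply/properP.
  by split; [apply: subsetDl|exists x; rewrite // !inE xb].
- move=> y; rewrite !inE => /andP[yb /Sc/andP[-> ->]]; rewrite !andbT.
  apply/andP; split; apply: contra yb => /zigzag_closed/andP[]; rewrite ?u0K ?uK //.
exists (b :: ss); split.
- by move=> c; rewrite inE => /orP[/eqP->|/s1//]; exact: alternating_zigzag.
- rewrite /= cat_uniq s2 andbT uniq_zigzag /=; apply/hasPn => y; rewrite s3 !inE.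
  by case/andP.
- move=> y; rewrite /= mem_cat s3 !inE; case: (boolP (y \in b)) => //= /bS -> //.
Qed.

(** The cyclic successor of a position inside its block. It depends only on the block sizes, so it
    describes [u] at odd positions alike for all covers of one shape. *)
Fixpoint next_in_block (sh : seq nat) (i : nat) : nat :=
  if sh is m :: sh' then
    if (i < m)%N then (if i.+1 == m then 0 else i.+1)%N
    else (m + next_in_block sh' (i - m))%N
  else 0%N.

Lemma nth_flatten_u0 ss i : (forall b, b \in ss -> alternating b) ->
  (i < size (flatten ss))%N -> ~~ odd i ->
  nth x0 (flatten ss) i.+1 = u0 (nth x0 (flatten ss) i).
Proof.
elim: ss i => //= b ss IH i alt; rewrite size_cat => lt ev.
have [p1 p2 p3 p4] := alt b (mem_head _ _).
rewrite !nth_cat; case: (ltnP i (size b)) => h.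
  by rewrite (_ : (i.+1 < size b)%N); [apply: p3|lia].
rewrite ltnNge (leq_trans h (leqnSn _)) /= subSn // IH //; try lia.
by move=> c cs; apply: alt; rewrite inE cs orbT.
Qed.

Lemma nth_flatten_u ss i : (forall b, b \in ss -> alternating b) ->
  (i < size (flatten ss))%N -> odd i ->
  nth x0 (flatten ss) (next_in_block (shape ss) i) = u (nth x0 (flatten ss) i).
Proof.
elim: ss i => //= b ss IH i alt; rewrite size_cat => lt od.
have [p1 p2 p3 p4] := alt b (mem_head _ _).
rewrite !nth_cat; case: (ltnP i (size b)) => h.
  rewrite -(p4 i h od); case: eqP => [|ne]; first by rewrite p1.
  by rewrite (_ : (i.+1 < size b)%N) //; lia.
rewrite ltnNge leq_addr /= addKn IH //; try lia.
by move=> c cs; apply: alt; rewrite inE cs orbT.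
Qed.

Lemma next_in_block_lt ss i : (forall b, b \in ss -> alternating b) ->
  (i < size (flatten ss))%N -> (next_in_block (shape ss) i < size (flatten ss))%N.
Proof.
elim: ss i => //= b ss IH i alt; rewrite size_cat => lt.
have [p1 _ _ _] := alt b (mem_head _ _).
case: (ltnP i (size b)) => h.
  by case: (i.+1 =P size b) => /= ?; lia.
rewrite ltn_add2l; apply: IH; last by lia.
by move=> c cs; apply: alt; rewrite inE cs orbT.
Qed.

Lemma alternating_sorted_cover : exists ss,
  [/\ forall b, b \in ss -> alternating b, uniq (flatten ss), flatten ss =i T
    & sorted geq (shape ss)].
Proof.
have [|ss [s1 s2 s3]] := @alternating_cover [set: T].
  by move=> x _; rewrite !inE.
pose ss' := sort (relpre size geq) ss.
have pe : perm_eq ss' ss by rewrite perm_sort.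
have pf : perm_eq (flatten ss') (flatten ss) by apply: perm_flatten.
exists ss'; split.
- by move=> b; rewrite (perm_mem pe); exact: s1.
- by rewrite (perm_uniq pf).
- by move=> x; rewrite (perm_mem pf) s3 inE.
- rewrite /shape sorted_map; apply: sort_sorted => a b; exact: leq_total.
Qed.

End TwoInvolutions.

(** * Conjugacy of pairs of matchings with equal cycle lengths *)

Section ConjugateInvolutions.
Variables (T : finType) (x0 : T) (u0 u u' : T -> T).
Hypotheses (u0K : involutive u0) (uK : involutive u) (u'K : involutive u').
Variables (ss ss' : seq (seq T)).
Hypotheses (alt : forall b, b \in ss -> alternating x0 u0 u b).
Hypotheses (alt' : forall b, b \in ss' -> alternating x0 u0 u' b).
Hypotheses (un : uniq (flatten ss)) (un' : uniq (flatten ss')).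
Hypothesis full : flatten ss =i T.
Hypothesis esh : shape ss = shape ss'.

(** Entries at equal positions of the two covers correspond. The involutions act on positions by
    rules fixed by the common shape. *)
Lemma involutions_conjugate : exists k : {perm T},
  (forall x, k (u0 x) = u0 (k x)) /\ (forall x, k (u x) = u' (k x)).
Proof.
have esz : size (flatten ss) = size (flatten ss') by rewrite !size_flatten esh.
pose k0 x := nth x0 (flatten ss') (index x (flatten ss)).
have kn i : (i < size (flatten ss))%N -> k0 (nth x0 (flatten ss) i) = nth x0 (flatten ss') i.
  by move=> hi; rewrite /k0 index_uniq.
have ex x : exists2 i, (i < size (flatten ss))%N & x = nth x0 (flatten ss) i.
  have xf : x \in flatten ss by rewrite full.
  by exists (index x (flatten ss)); rewrite ?index_mem ?nth_index.
have kI : injective k0.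
  move=> x y; have [i hi ->] := ex x; have [j hj ->] := ex y.
  rewrite !kn // => /eqP; rewrite nth_uniq -?esz // => /eqP -> //.
have ev : ~~ odd (size (flatten ss)).
  elim: (ss) (alt) => //= b s IH al; rewrite size_cat oddD (negPf (IH _)) ?addbF.
    by have [] := al b (mem_head _ _).
  by move=> c cs; apply: al; rewrite inE cs orbT.
exists (perm kI); split=> x; rewrite !permE.
  have E i : (i < size (flatten ss))%N -> ~~ odd i ->
      k0 (u0 (nth x0 (flatten ss) i)) = u0 (k0 (nth x0 (flatten ss) i)).
    move=> hi oi; have hi' : (i.+1 < size (flatten ss))%N by lia.
    by rewrite -(nth_flatten_u0 alt) // !kn // (nth_flatten_u0 alt') // -esz.
  have [i hi ->] := ex x; case: (boolP (odd i)) => oi; last exact: E.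
  have h0 : (i.-1 < size (flatten ss))%N by lia.
  have := nth_flatten_u0 alt h0; rewrite prednK; last by lia.
  move=> /(_ ltac:(lia)) ->; rewrite E //; last by lia.
  by rewrite !u0K.
have E i : (i < size (flatten ss))%N -> odd i ->
    k0 (u (nth x0 (flatten ss) i)) = u' (k0 (nth x0 (flatten ss) i)).
  move=> hi oi; rewrite -(nth_flatten_u alt) // !kn //; last exact: next_in_block_lt alt hi.
  by rewrite esh (nth_flatten_u alt') // -esz.
have [i hi ->] := ex x; case: (boolP (odd i)) => oi; first exact: E.
(* An even position is the successor of an odd one, where the claim is known; it transfers because
   [u] and [u'] are involutions. *)
have [j [hj oj ej]] : exists j, [/\ (j < size (flatten ss))%N, odd j &
    u (nth x0 (flatten ss) j) = nth x0 (flatten ss) i].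
  suff [j [hj oj ej]] : exists j, [/\ (j < size (flatten ss))%N, odd j &
      next_in_block (shape ss) j = i].
    by exists j; split=> //; rewrite -(nth_flatten_u alt) // ej.
  elim: (ss) (alt) (i) hi oi => //= b s IH al j; rewrite size_cat => hj oj.
  have [p1 p2 _ _] := al b (mem_head _ _).
  case: (ltnP j (size b)) => h.
    have [j0|j0] := posnP j.
      (* Position 0 of a block follows its last position. *)
      exists (size b).-1; split; try lia.
      rewrite prednK // leqnn eqxx j0 //.
    exists j.-1; split; try lia.
    by rewrite prednK // (ltnW h) ltn_eqF.
  have [|||m [hm om em]] := IH _ (j - size b)%N; try lia.
    by move=> c cs; apply: al; rewrite inE cs orbT.
  exists (size b + m)%N; split; try lia.
  by rewrite ltnNge leq_addr /= addKn em subnKC.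
by rewrite -ej uK E // u'K.
Qed.

End ConjugateInvolutions.

(** * Double cosets and even partitions *)

Section Mate.
Variable k : nat.
Local Notation n := k.*2.
Implicit Types (x y : 'I_n) (h g : 'S_n).

Fact mate_subproof x : ((if odd x then x.-1 else x.+1) < n)%N.
Proof. have := ltn_ord x; case: ifP; lia. Qed.

Definition mate x : 'I_n := Ordinal (mate_subproof x).

Lemma mateK : involutive mate.
Proof. move=> x; apply: val_inj => /=; case: (boolP (odd x)); case: ifP; lia. Qed.

Lemma mateN x : mate x != x.
Proof. apply/eqP => /(congr1 val) /=; case: ifP; lia. Qed.

Lemma mate_half x : (mate x)./2 = x./2.
Proof. rewrite /=; case: ifP; lia. Qed.

Lemma half_eqE x y : (x./2 == y./2) = (y == x) || (y == mate x).
Proof.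
apply/eqP/orP => [h|[/eqP->//|/eqP->]]; last by rewrite mate_half.
have : (y = x :> nat) \/ (y = mate x :> nat) by rewrite /=; case: ifP; lia.
by case=> /val_inj ->; rewrite eqxx; [left|right].
Qed.

Lemma HkP h : reflect (forall x, h (mate x) = mate (h x)) (h \in Hk k).
Proof.
rewrite inE; apply: (iffP forallP) => [H x|H a].
  have /forallP/(_ (mate x))/implyP := H x; rewrite mate_half eqxx => /(_ isT).
  by rewrite half_eqE (inj_eq perm_inj) (negPf (mateN x)) => /eqP.
apply/forallP => b; apply/implyP; rewrite half_eqE => /orP[] /eqP -> //.
by rewrite H mate_half.
Qed.

Lemma Hk_group_set : group_set (Hk k).
Proof.
apply/group_setP; split; first by apply/HkP => a; rewrite !perm1.
by move=> s t /HkP hs /HkP ht; apply/HkP => a; rewrite !permM hs ht.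
Qed.
Canonical Hk_group := Group Hk_group_set.

(* [t] is the product of its restriction to [c] and the conjugate of that by [mate]. *)
Lemma even_commuting (c : 'I_n -> bool) (t : 'S_n) :
  (forall x, c (t x) = c x) -> (forall x, c (mate x) = ~~ c x) ->
  (forall x, t (mate x) = mate (t x)) -> odd_perm t = false.
Proof.
move=> ct cm tm; pose t1 x := if c x then t x else x.
have t1I : injective t1.
  move=> x y; rewrite /t1; case: ifP => cx; case: ifP => cy // e; first exact: perm_inj e.
    by move: cy; rewrite -e ct cx.
  by move: cx; rewrite e ct cy.
pose mp := perm (inv_inj mateK).
have -> : t = (perm t1I * (perm t1I ^ mp))%g.
  have mpV x : (mp^-1)%g x = mate x.
    by apply: (@perm_inj _ mp); rewrite permKV permE mateK.
  apply/permP => x; rewrite permM conjgE !permM mpV !permE /t1.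
  by case cx: (c x); rewrite cm ?ct cx /= ?mateK // tm mateK.
by rewrite odd_permM odd_permJ addbb.
Qed.

Definition conj_mate g x := g (mate ((g^-1)%g x)).

Lemma conj_mateK g : involutive (conj_mate g).
Proof. by move=> x; rewrite /conj_mate permK mateK permKV. Qed.

Lemma conj_mateN g x : conj_mate g x != x.
Proof. by rewrite -[X in _ != X](permKV g x) (inj_eq perm_inj) mateN. Qed.

(** The map [w] lies in [Hk]; as it carries one transported matching to the other, [g * w * g'^-1]
    preserves the standard matching too. *)
Lemma conj_mate_double_coset g g' (w : 'S_n) :
  (forall x, w (mate x) = mate (w x)) ->
  (forall x, w (conj_mate g x) = conj_mate g' (w x)) ->
  exists h h', [/\ h \in Hk k, h' \in Hk k & g = (h * g' * h')%g].
Proof.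
move=> w1 w2; exists (g * w * g'^-1)%g, (w^-1)%g; split.
- apply/HkP => x; rewrite !permM; apply: (@perm_inj _ g'); rewrite permKV.
  by have := w2 (g x); rewrite /conj_mate permK => ->.
- by rewrite groupV /=; apply/HkP.
- by rewrite mulgKV mulgK.
Qed.

End Mate.

(** Cycle lengths are stored as a zero-padded tuple so that double cosets are indexed by the same
    set as the summands. *)
Lemma pad_partition n (sh : seq nat) : sorted geq sh -> all (fun x => 0 < x)%N sh ->
  all (fun x => ~~ odd x) sh -> sumn sh = n ->
  exists2 l : ptn n, is_evpart l & [seq x <- map val l | (0 < x)%N] = sh.
Proof.
move=> so po ev su.
have szle : (size sh <= n)%N.
  rewrite -su; elim: (sh) po => //= x s IH /andP[x0 /IH]; lia.
have lele x : x \in sh -> (x <= n)%N.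
  rewrite -su; elim: (sh) => //= y s IH; rewrite inE => /orP[/eqP->|/IH]; lia.
pose s := sh ++ nseq (n - size sh) 0%N.
have sz : size (map (@inord n) s) == n by rewrite size_map size_cat size_nseq subnKC.
have vl : map val (Tuple sz) = s.
  rewrite /= -map_comp -[RHS]map_id; apply/eq_in_map => x xs /=.
  rewrite inordK // ltnS; move: xs; rewrite mem_cat mem_nseq.
  by case/orP=> [/lele//|/andP[_ /eqP->]].
exists (Tuple sz); last first.
  rewrite vl filter_cat (all_filterP po) -[RHS]cats0; congr cat.
  by apply/eqP; rewrite -[_ == _]negbK -has_filter has_nseq andbF.
rewrite /is_evpart /is_part vl all_cat ev sumn_cat su sumn_nseq mul0n addn0 eqxx !andbT.
have tr : transitive geq by move=> a b c h1 h2; exact: leq_trans h2 h1.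
apply/andP; split; last by rewrite all_nseq orbT.
rewrite (sorted_pairwise tr) pairwise_cat -(sorted_pairwise tr) so /=; apply/andP; split.
  by apply/allrelP => x y _; rewrite mem_nseq => /andP[_ /eqP->].
by elim: (n - size sh)%N => //= m ->; rewrite all_nseq /= orbT.
Qed.

Lemma double_coset_types k : exists typ : 'S_k.*2 -> ptn k.*2,
  (forall g, is_evpart (typ g)) /\
  (forall g g', typ g = typ g' ->
     exists h h', [/\ h \in Hk k, h' \in Hk k & g = (h * g' * h')%g]).
Proof.
case: k => [|k].
  (* The empty case is separate because lists of positions need a default point [x0]. *)
  exists (fun _ => [tuple]); split=> [g|g g' _]; first by [].
  exists 1%g, 1%g; split; rewrite ?group1 // mulg1 mul1g.
  by apply/permP; case.
pose x0 : 'I_k.+1.*2 := Ordinal (isT : (0 < k.+1.*2)%N).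
(* Here [l] records the cycle lengths of the union of the standard matching and its image under
   [g]. *)
pose P g (l : ptn k.+1.*2) := is_evpart l /\ exists ss : seq (seq 'I_k.+1.*2),
  [/\ forall b, b \in ss -> alternating x0 (@mate k.+1) (conj_mate g) b,
      uniq (flatten ss), flatten ss =i 'I_k.+1.*2
    & shape ss = [seq x <- map val l | (0 < x)%N]].
have [|typ typP] := @fin_all_exists _ _ P.
  move=> g.
  have [ss [s1 s2 s3 s4]] := alternating_sorted_cover x0 (@mateK k.+1) (conj_mateK g)
     (@mateN k.+1) (conj_mateN g).
  have [|||l le lf] := @pad_partition k.+1.*2 (shape ss) s4.
  - by apply/allP => x /mapP[b /s1[]] ? ? _ _ ->.
  - by apply/allP => x /mapP[b /s1[]] ? ? _ _ ->.
  - rewrite -size_flatten -(card_uniqP s2) -[RHS]card_ord; exact: eq_card.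
  by exists l; split=> //; exists ss.
exists typ; split=> [g|g g' e]; first by have [] := typP g.
have [_ [ss [s1 s2 s3 s4]]] := typP g; have [_ [ss' [s1' s2' s3' s4']]] := typP g'.
have [|w [w1 w2]] := involutions_conjugate (@mateK k.+1) (conj_mateK g) (conj_mateK g') s1 s1' s2 s2' s3.
  by rewrite s4 s4' e.
exact: conj_mate_double_coset w1 w2.
Qed.

(** * Rows and columns of the consecutive filling *)

Section PartitionShape.
Variables (n : nat).
Implicit Types (l m : ptn n) (x y : 'I_n).

Lemma cumS l r : cum l r.+1 = (cum l r + lam l r)%N.
Proof. by rewrite /cum big_ord_recr. Qed.

Lemma leq_cum l r r' : (r <= r')%N -> (cum l r <= cum l r')%N.
Proof.
move/subnKC <-; elim: (r' - r)%N => [|d IH]; first by rewrite addn0.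
by rewrite addnS cumS (leq_trans IH) ?leq_addr.
Qed.

Lemma cum_size l : is_part l -> cum l n = n.
Proof.
case/andP=> _ /eqP e; rewrite -[RHS]e /cum sumnE (big_nth 0%N) size_map size_tuple.
by rewrite big_mkord.
Qed.

(** [row_of] counts the rows that end at or before [x]; by monotonicity of [cum] these are exactly
    the first [r] ones. *)
Lemma row_of_uniq l r x : is_part l -> (cum l r <= x < cum l r.+1)%N -> row_of l x = r.
Proof.
move=> lp /andP[h1 h2].
have rn : (r < n)%N.
  rewrite ltnNge; apply/negP => /(leq_cum l); rewrite cum_size // leqNgt => /negP; apply.
  exact: leq_ltn_trans h1 (ltn_ord x).
rewrite /row_of -[RHS](card_ord r).
have -> : [set i : 'I_n | (cum l i.+1 <= x)%N] = [set widen_ord (ltnW rn) i | i : 'I_r].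
  apply/setP => i; rewrite inE; apply/idP/imsetP => [hi|[j _ ->]].
    have ir : (i < r)%N.
      by rewrite ltnNge; apply/negP => /(leq_cum l (r := r.+1) (r' := i.+1)); lia.
    by exists (Ordinal ir) => //; apply: val_inj.
  by apply: leq_trans h1; apply: leq_cum; exact: (ltn_ord j).
by rewrite card_imset // => i j /(congr1 val) /= /val_inj.
Qed.

Lemma row_ofP l x : is_part l -> (cum l (row_of l x) <= x < cum l (row_of l x).+1)%N.
Proof.
move=> lp.
have ex : exists r, (x < cum l r.+1)%N.
  by exists n.-1; rewrite prednK ?cum_size // (leq_ltn_trans (leq0n x)).
have [r xr rmin] := ex_minnP ex.
have h : (cum l r <= x < cum l r.+1)%N.
  rewrite xr andbT; case: r xr rmin => [|r] xr rmin; first by rewrite /cum big_ord0.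
  by rewrite leqNgt; apply/negP => /rmin; rewrite ltnn.
by rewrite (row_of_uniq lp h).
Qed.

Lemma cellE l x : is_part l -> nat_of_ord x = (cum l (row_of l x) + col_of l x)%N.
Proof. by move=> lp; have /andP[h _] := row_ofP x lp; rewrite /col_of subnKC. Qed.

Lemma col_of_lt l x : is_part l -> (col_of l x < lam l (row_of l x))%N.
Proof.
by move=> lp; have /andP[_] := row_ofP x lp; rewrite cumS {1}(cellE x lp) ltn_add2l.
Qed.

Lemma cell_exists l r c : is_part l -> (c < lam l r)%N ->
  exists x, row_of l x = r /\ col_of l x = c.
Proof.
move=> lp cr.
have lt : (cum l r + c < n)%N.
  apply: (@leq_trans (cum l r.+1)); first by rewrite cumS ltn_add2l.
  apply: leq_trans (_ : cum l n <= n)%N; last by rewrite cum_size.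
  apply: leq_cum; rewrite ltnNge; apply/negP => h; move: cr.
  by rewrite /lam nth_default // size_map size_tuple.
have e : row_of l (Ordinal lt) = r.
  by apply: row_of_uniq; rewrite //= leq_addr cumS ltn_add2l.
by exists (Ordinal lt); rewrite /col_of e /= addKn.
Qed.

Lemma leq_lam l r r' : is_part l -> (r <= r')%N -> (lam l r' <= lam l r)%N.
Proof.
case/andP=> so _ rr; have [h|h] := ltnP r' n; last first.
  by rewrite {1}/lam nth_default // size_map size_tuple.
apply: (sorted_leq_nth (leT := geq)) => //.
- by move=> a b c h1 h2; exact: leq_trans h2 h1.
- exact: leqnn.
- by rewrite inE size_map size_tuple (leq_ltn_trans rr).
- by rewrite inE size_map size_tuple.
Qed.

Lemma part_shape l : is_part l -> is_shape (row_of l) (col_of l).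
Proof.
move=> lp; split=> [x y r c|x r c hr hc].
  by apply: val_inj; rewrite /= (cellE x lp) (cellE y lp) r c.
apply: cell_exists => //; apply: leq_ltn_trans hc _.
exact: leq_trans (col_of_lt x lp) (leq_lam lp hr).
Qed.

Lemma card_row l r : is_part l -> #|[set x | row_of l x == r]| = lam l r.
Proof.
move=> lp; have [rcI _] := part_shape lp.
apply/eqP; rewrite eqn_leq; apply/andP; split.
  apply: (@card_le_inj _ _ (col_of l)) => [x y|x]; rewrite !inE => /eqP rx.
    by move=> /eqP ry; apply: rcI; rewrite rx.
  by rewrite -rx; exact: col_of_lt.
apply: (@card_ge_surj _ _ (col_of l)) => c /(cell_exists lp)[x [xr xc]].
by exists x; rewrite // inE xr.
Qed.

Lemma row_of_inj l m (s : 'S_n) : is_part l -> is_part m ->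
  (forall x, row_of l (s x) = row_of m x) -> l = m.
Proof.
move=> lp mp e.
have E r : lam l r = lam m r.
  rewrite -!card_row //.
  have -> : [set x | row_of m x == r] = s @^-1: [set x | row_of l x == r].
    by apply/setP => x; rewrite !inE e.
  by rewrite card_preimset //; exact: perm_inj.
apply: val_inj; apply: (inj_map val_inj); apply: (@eq_from_nth _ 0%N).
  by rewrite !size_map !size_tuple.
by move=> r _; exact: E.
Qed.

End PartitionShape.

Section EvenPartition.
Variables (k : nat) (l : ptn k.*2).
Hypothesis le : is_evpart l.
Let lp : is_part l. Proof. by case/andP: le. Qed.

Lemma lam_even r : ~~ odd (lam l r).
Proof.
case/andP: le => _ /allP ev; have [h|h] := ltnP r k.*2.
  by apply: ev; apply: mem_nth; rewrite size_map size_tuple.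
by rewrite /lam nth_default // size_map size_tuple.
Qed.

Lemma cum_even r : ~~ odd (cum l r).
Proof.
elim: r => [|r IH]; first by rewrite /cum big_ord0.
by rewrite cumS oddD (negPf IH) (negPf (lam_even r)).
Qed.

(** Rows of even length start at even positions, so no pair of the matching straddles two rows. *)
Lemma row_of_mate x : row_of l (mate x) = row_of l x.
Proof.
apply: row_of_uniq => //; have := row_ofP x lp.
have := cum_even (row_of l x); have := cum_even (row_of l x).+1.
rewrite /=; case: ifP; lia.
Qed.

Lemma col_of_mate x :
  col_of l (mate x) = if odd (col_of l x) then (col_of l x).-1 else (col_of l x).+1.
Proof.
have := cellE (mate x) lp; rewrite row_of_mate /= {1 2 3}(cellE x lp).
have := cum_even (row_of l x); rewrite oddD => /negPf -> /=.
by case: ifP; lia.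
Qed.

(** The product [t * s] lies in [Hk]. As [s] preserves rows, [t] preserves columns and [mate] moves
    columns by a rule independent of the row, [t] itself commutes with [mate]. It preserves the
    column parity, which [mate] reverses, so [even_commuting] applies. *)
Lemma even_column_perm s t h : s \in Rt l -> t \in Ct l -> h \in Hk k ->
  (t * s * h = 1)%g -> odd_perm t = false.
Proof.
move=> /(stabP (row_of l)) sR /(stabP (col_of l)) tC hH e.
have ts : (t * s)%g \in Hk k.
  by rewrite -[(t * s)%g](mulgK h) e mul1g groupV.
have tm x : t (mate x) = mate (t x).
  have [rcI _] := part_shape lp; apply: rcI; last by rewrite tC !col_of_mate tC.
  rewrite row_of_mate -sR -permM; move/HkP: ts => ->.
  by rewrite row_of_mate permM sR.
apply: (even_commuting (c := fun x => odd (col_of l x))) => // x; rewrite ?tC //.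
by rewrite col_of_mate; case: ifP => o; lia.
Qed.

End EvenPartition.

(** * Spanning by the zonal elements *)

Section CharZero.
Variable F : fieldType.
Hypothesis HF : [pchar F] =i pred0.

Lemma intr_eq0_char0 (z : int) : (z%:~R == 0 :> F) = (z == 0).
Proof.
by case: z => m; rewrite ?NegzE ?mulrNz ?oppr_eq0 -pmulrn (proj1 (pcharf0P F) HF).
Qed.

Lemma natr_neq0_char0 m : (0 < m)%N -> m%:R != 0 :> F.
Proof. by rewrite (proj1 (pcharf0P F) HF) -lt0n. Qed.

Lemma torsion_free (V : lmodType F) (z : int) (v : V) : z != 0 -> z%:~R *: v = 0 -> v = 0.
Proof. by move=> z0 /eqP; rewrite scaler_eq0 intr_eq0_char0 (negPf z0) => /eqP. Qed.

End CharZero.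

Lemma free_map_enum (K : fieldType) (vT : vectType K) (I : finType) (P : pred I) (f : I -> vT) :
  (forall c : I -> K, \sum_(i | P i) c i *: f i = 0 -> forall i, P i -> c i = 0) ->
  free [seq f i | i <- enum P].
Proof.
move=> ind; pose X := map_tuple f (enum_tuple P).
suff: free X by [].
apply/freeP => c c0.
pose c' x := \sum_(i | enum_val i == x) c i.
have c'E i : c' (enum_val i) = c i.
  by rewrite /c' (big_pred1 i) // => j; rewrite (inj_eq enum_val_inj).
move=> i; rewrite -c'E; apply: ind; last exact: enum_valP.
rewrite (big_enum_val (A := P) (fun x => c' x *: f x)) /= -[RHS]c0.
apply: eq_bigr => j _; rewrite c'E; congr (_ *: _).
rewrite (nth_map (enum_val j)) ?size_tuple //.
by congr (f _); exact: enum_val_nth.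
Qed.

Section Completeness.
Variables (F : fieldType) (k : nat).
Hypothesis HF : [pchar F] =i pred0.
Local Notation n := k.*2.
Local Notation e act := (symz act (Hk k)).
Local Notation a act l := (symz act (Rt l)).
Local Notation b act l := (altz act (Ct l)).
Local Notation regT := {ffun 'S_n -> F^o}.
Local Notation d := (@reg_delta F n).

Lemma kappa_evpart_neq0 (l : ptn n) : is_evpart l -> kappa (row_of l) (col_of l) (Hk k) != 0.
Proof.
move=> le; apply: (@kappa_neq0 _ _ _ (Hk_group k)).
  by apply: part_shape; case/andP: le.
by move=> s t h; exact: even_column_perm.
Qed.

Definition zonal (l : ptn n) : regT :=
  e regL (a regL l (b regL l (a regL l (e regL d)))).

Lemma zonal_at1_neq0 l : is_evpart l -> zonal l 1%g != 0.
Proof.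
move=> le; have lp : is_part l by case/andP: le.
have := @eabae_at1_neq0 _ (row_of l) (col_of l) (Hk_group k)
  (fun s t h => @even_column_perm _ _ le s t h).
rewrite -(intr_eq0_char0 HF) /zonal -(reg_intr_delta F n).
by rewrite -!(reg_intr_symz, reg_intr_altz) [X in _ -> X != 0]ffunE.
Qed.

(** [pf_independent] is applied to the inner vectors [c l *: a (e d)]; the nonzero value of
    [zonal l] at 1 then forces [c l = 0]. *)
Lemma zonal_free : free [seq zonal l | l <- enum (@is_evpart n)].
Proof.
apply: free_map_enum => c c0 l le.
have := @pf_independent _ _ _ _ (regL_act F n) (@torsion_free _ HF _) _ (@is_evpart n)
  (@row_of n) (@col_of n) (Hk_group k) _ _ kappa_evpart_neq0
  (fun l => c l *: a regL l (e regL d)) _ l le.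
move=> h; have {h} : a regL l (b regL l (c l *: a regL l (e regL d))) = 0.
  apply: h => [m /andP[mp _]|m m' s /andP[mp _] /andP[mp' _]|].
  - exact: part_shape.
  - exact: row_of_inj.
  rewrite -[RHS]c0; apply: eq_bigr => m _ /=.
  by rewrite /zonal !linearZ.
rewrite !linearZ /= => /(congr1 (e regL)); rewrite linear0 linearZ /= -/(zonal l).
move/ffunP/(_ 1%g)/eqP; rewrite !ffunE mulf_eq0 (negPf (zonal_at1_neq0 le)) orbF.
by move/eqP.
Qed.

(* The algebra e A e is spanned by as many elements as there are double cosets of Hk. *)
Lemma zonal_span : e regL d \in <<[seq zonal l | l <- enum (@is_evpart n)]>>%VS.
Proof.
have [typ [typE typD]] := double_coset_types k.
pose E (g : 'S_n) : regT := e regL (regL g (e regL d)).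
pose E' l := if [pick g | typ g == l] is Some g then E g else 0.
have EE g : E g = E' (typ g).
  rewrite /E'; case: pickP => [g' /eqP /esym tg|/(_ g)]; last by rewrite eqxx.
  have [h [h' [hH hH' ->]]] := typD _ _ tg.
  rewrite /E !(actM (regL_act F n)) (symz_act (regL_act F n) (G := Hk_group k)) //.
  by rewrite (act_symz (regL_act F n) (G := Hk_group k)).
set Z := [seq zonal l | l <- _]; pose X := [seq E' l | l <- enum (@is_evpart n)].
have EX g : E g \in <<X>>%VS.
  rewrite EE; apply: memv_span; apply: map_f; rewrite mem_enum; exact: typE.
have ZX : (<<Z>> <= <<X>>)%VS.
  (* [Q] is stable under row and column sums, so it passes from [e d] through the factors of
     [zonal l]. *)
  pose Q x := forall g, e regL (regL g x) \in <<X>>%VS.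
  have QS A x : Q x -> Q (symz regL A x).
    move=> Qx g; rewrite !linear_sum; apply: memv_suml => s _ /=.
    by rewrite -(actM (regL_act F n)).
  have QA A x : Q x -> Q (altz regL A x).
    move=> Qx g; rewrite !linear_sum; apply: memv_suml => s _ /=.
    by rewrite !linearZ /= rpredZ // -(actM (regL_act F n)).
  apply/span_subvP => z /mapP[l _ ->].
  by have := QS (Rt l) _ (QA (Ct l) _ (QS (Rt l) _ EX)) 1%g; rewrite (act1 (regL_act F n)).
have -> : <<Z>>%VS = <<X>>%VS.
  (* [Z] is free with one vector per even partition and [X] has as many generators, so the inclusion
     is an equality. *)
  apply/eqP; rewrite eqEdim ZX (eqnP zonal_free) size_map -(size_map E').
  exact: dim_span.
have H0 : (#|Hk_group k|%:R : F) != 0 by apply: natr_neq0_char0; rewrite // cardG_gt0.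
rewrite -[e regL d](scalerK H0); apply: rpredZ.
rewrite -(symz_symz (regL_act F n) (Hk_group k)).
by have := EX 1%g; rewrite /E (act1 (regL_act F n)).
Qed.

Lemma symz_pf_decomposition (V : lmodType F) (act : 'S_n -> {linear V -> V}) : is_act act ->
  exists c : ptn n -> F, forall v,
  e act v = \sum_(l | is_evpart l) c l *: e act (a act l (b act l (a act l (e act v)))).
Proof.
move=> actP.
have := zonal_span; rewrite span_def big_map big_enum /= => /memv_sumP[u uZ ue].
have [|c cP] := @fin_all_exists _ _ (fun l c => is_evpart l -> u l = c *: zonal l).
  move=> l; case le : (is_evpart l); last by exists 0.
  by have /vlineP[x ->] := uZ _ le; exists x.
exists c => v.
(* Evaluation at [v]: the module map from the regular module taking [d] to [v]. It carries the
   expansion of e to any action. *)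
pose ev (x : regT) := \sum_g x g *: act g v.
have evD I r (P : pred I) (x : I -> regT) : ev (\sum_(i <- r | P i) x i) = \sum_(i <- r | P i) ev (x i).
  rewrite /ev exchange_big; apply: eq_bigr => g _ /=.
  by rewrite sum_ffunE scaler_suml.
have evZ z x : ev (z *: x) = z *: ev x.
  by rewrite /ev scaler_sumr; apply: eq_bigr => g _; rewrite ffunE scalerA.
have evA s x : ev (regL s x) = act s (ev x).
  rewrite /ev linear_sum (reindex_inj (mulIg s)); apply: eq_bigr => g _ /=.
  by rewrite ffunE mulgK linearZ actM.
have evS A x : ev (symz regL A x) = symz act A (ev x).
  by rewrite evD; apply: eq_bigr => s _; rewrite evA.
have evT A x : ev (altz regL A x) = altz act A (ev x).
  by rewrite evD; apply: eq_bigr => s _; rewrite evZ evA.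
have evd : ev d = v.
  rewrite /ev (bigD1 1%g) //= big1 ?addr0 => [|g /negPf g1]; rewrite ffunE ?g1 ?scale0r //.
  by rewrite eqxx scale1r act1.
rewrite -{1}evd -evS ue evD; apply: eq_bigr => l le.
by rewrite cP // evZ /zonal !(evS, evT) evd.
Qed.

End Completeness.

(** * The Koszul sign action *)

Section PairProducts.
Variables (R : comNzRingType) (n : nat).
Implicit Types (f : 'I_n -> 'I_n -> R) (s t : 'S_n).

(** A symmetric [f] depends only on the unordered pair, and [srt] picks the increasing
    representative of the image pair. *)
Lemma prod_pairs_perm f t : (forall x y, x != y -> f x y = f y x) ->
  \prod_(x : 'I_n) \prod_(y : 'I_n | (x < y)%N) f (t x) (t y) =
  \prod_(x : 'I_n) \prod_(y : 'I_n | (x < y)%N) f x y.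
Proof.
move=> fC; rewrite !pair_big_dep /=.
pose srt (q : 'I_n * 'I_n) := if (q.1 < q.2)%N then q else (q.2, q.1).
pose h (u : 'S_n) (q : 'I_n * 'I_n) := srt (u q.1, u q.2).
have hK (u v : 'S_n) (q : 'I_n * 'I_n) : (forall x, v (u x) = x) -> (q.1 < q.2)%N -> h v (h u q) = q.
  case: q => x y uv /= lt; rewrite /h /srt /=; case: (ltnP (u x) (u y)) => /= _; rewrite !uv ?lt //.
  by rewrite ltnNge (ltnW lt).
have hlt (u : 'S_n) (q : 'I_n * 'I_n) : (q.1 < q.2)%N -> ((h u q).1 < (h u q).2)%N.
  case: q => x y /= lt; rewrite /h /srt /=; case: (ltnP (u x) (u y)) => //= le.
  rewrite ltn_neqAle le andbT; apply/eqP => /val_inj/perm_inj e.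
  by move: lt; rewrite e ltnn.
rewrite [RHS](reindex_onto (h t) (h t^-1%g)) /=; last first.
  by move=> q lt; apply: hK => // x; rewrite permKV.
apply: eq_big => [q|[x y] /= lt].
  apply/idP/andP => [lt|[lt /eqP <-]]; last exact: hlt.
  by split; [apply: hlt|apply/eqP; apply: hK => // x; rewrite permK].
rewrite /h /srt /=; case: ifP => //= _; apply: fC.
by rewrite (inj_eq perm_inj); apply/eqP => e; move: lt; rewrite e ltnn.
Qed.

(** Isolates the pairs containing [r], the only ones where changing the entry at [r] affects a
    Koszul sign. *)
Lemma prod_pairs_at (g : 'I_n -> R) r :
  \prod_(x : 'I_n) \prod_(y : 'I_n | (x < y)%N) ((if x == r then g y else 1) * (if y == r then g x else 1)) =
  \prod_(y | y != r) g y.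
Proof.
transitivity ((\prod_(x : 'I_n) \prod_(y : 'I_n | (x < y)%N) (if x == r then g y else 1)) *
  (\prod_(x : 'I_n) \prod_(y : 'I_n | (x < y)%N) (if y == r then g x else 1))).
  by rewrite -big_split; apply: eq_bigr => x _ /=; rewrite -big_split.
rewrite (bigD1 r) //= [X in _ * X * _]big1 ?mulr1; last first.
  by move=> x /negPf ->; rewrite big1.
rewrite eqxx [X in _ * X](_ : _ = \prod_(x : 'I_n | (x < r)%N) g x); last first.
  rewrite [RHS]big_mkcond; apply: eq_bigr => x _; case: ltnP => h.
    by rewrite (bigD1 r) //= eqxx big1 ?mulr1 // => y /andP[_ /negPf ->].
  by rewrite big1 // => y lt; case: eqP => // e; move: lt; rewrite e ltnNge h.
rewrite [RHS](bigID (fun y : 'I_n => (r < y)%N)) /=; congr (_ * _); apply: eq_bigl => y.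
  by rewrite andb_idl // => lt; apply/eqP => e; move: lt; rewrite e ltnn.
by rewrite -leqNgt ltn_neqAle.
Qed.

End PairProducts.

Section KoszulAction.
Variables (F : fieldType) (p q n : nat).
Local Notation tensor := (tensorT F p q n).
Local Notation sq := (seqT p q n).
Implicit Types (I J : sq) (s t : 'S_n) (v : tensor).
Local Notation w := (@basisv F p q n).
Local Notation upd I r a := [ffun s : 'I_n => if s == r then a else I s].

(** The exclusive or makes inversion symmetric in distinct points and additive under products. *)
Definition inverted s (x y : 'I_n) : bool := (x < y)%N (+) (s x < s y)%N.

Lemma invertedC s x y : x != y -> inverted s x y = inverted s y x.
Proof.
move=> nxy; rewrite /inverted; have : s x != s y :> nat by rewrite (inj_eq val_inj) (inj_eq perm_inj).
by have : x != y :> nat by []; case: (ltngtP x y) => // _ _; case: (ltngtP (s x) (s y)).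
Qed.

Lemma invertedM s t x y : inverted (t * s)%g x y = inverted t x y (+) inverted s (t x) (t y).
Proof. by rewrite /inverted !permM addbA -[_ (+) _ (+) (t x < t y)%N]addbA addbb addbF. Qed.

Definition koszul (O : pred 'I_n) s : F :=
  \prod_(x : 'I_n) \prod_(y : 'I_n | (x < y)%N) (-1) ^+ [&& inverted s x y, O x & O y].

Lemma ksignE I s : ksign F I (s^-1)%g = koszul (fun x => par (I x)) s.
Proof.
rewrite /koszul pair_big_dep /= /ksign.
pose A := [set xy : 'I_n * 'I_n | (xy.1 < xy.2)%N && [&& inverted s xy.1 xy.2, par (I xy.1) & par (I xy.2)]].
transitivity ((-1) ^+ #|A| : F); last first.
  rewrite -prodr_const big_mkcond [RHS]big_mkcond /=; apply: eq_bigr => xy _.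
  by rewrite inE; case: ltnP => //= _; case: ifP.
(* An inversion of [s] at [x < y] is the inversion of [s^-1] at [(s y, s x)]. *)
congr (_ ^+ _); pose f (xy : 'I_n * 'I_n) := (s xy.2, s xy.1).
have fI : injective f by move=> [x y] [x' y'] [/perm_inj -> /perm_inj ->].
rewrite -[RHS](card_imset _ fI); apply: eq_card => -[x y].
rewrite -[x](permKV s) -[y](permKV s); move: (s^-1 x)%g (s^-1 y)%g => {}x {}y.
rewrite (mem_imset _ (y, x) fI) !inE /= !permK /inverted.
have [->|nxy] := eqVneq x y; first by rewrite !ltnn.
have : s x != s y :> nat by rewrite (inj_eq val_inj) (inj_eq perm_inj).
have : x != y :> nat by [].
by case: (ltngtP x y) => // _ _; case: (ltngtP (s x) (s y)) => //= _ _; rewrite andbC.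
Qed.

Lemma koszulM O s t : koszul O (t * s)%g = koszul O t * koszul (fun x => O (t^-1%g x)) s.
Proof.
pose f x y : F := (-1) ^+ [&& inverted s x y, O (t^-1%g x) & O (t^-1%g y)].
have -> : koszul (fun x => O (t^-1%g x)) s = \prod_(x : 'I_n) \prod_(y : 'I_n | (x < y)%N) f (t x) (t y).
  rewrite (@prod_pairs_perm _ _ f) // => x y nxy.
  by rewrite /f invertedC // [O _ && _]andbC.
rewrite -big_split; apply: eq_bigr => x _ /=.
rewrite -big_split; apply: eq_bigr => y _ /=; rewrite /f !permK invertedM.
by case: (O x) (O y) => [] []; rewrite ?andbT ?andbF ?mulr1 // signr_addb.
Qed.

Lemma koszul_eq1 (O : pred 'I_n) s :
  (forall x y : 'I_n, (x < y)%N -> O x -> O y -> (s x < s y)%N) -> koszul O s = 1.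
Proof.
move=> h; rewrite /koszul big1 // => x _; rewrite big1 // => y lt.
by rewrite /inverted lt; case ox: (O x); case oy: (O y); rewrite ?andbF // h.
Qed.

Lemma pactE s I x : pact s I (s x) = I x.
Proof. by rewrite ffunE permK. Qed.

Lemma pact1 I : pact 1%g I = I.
Proof. by apply/ffunP => x; rewrite ffunE invg1 perm1. Qed.

Lemma pactM s t I : pact (s * t)%g I = pact t (pact s I).
Proof. by apply/ffunP => x; rewrite !ffunE invMg permM. Qed.

Lemma tensor_basis v : v = \sum_I v I *: w I.
Proof.
apply/ffunP => J; rewrite sum_ffunE (bigD1 J) //= big1 ?addr0 => [|I].
  by rewrite !ffunE eqxx [RHS]mulr1.
by rewrite eq_sym !ffunE => /negPf ->; exact: mulr0.
Qed.

Lemma linear_basis_eq (V : lmodType F) (f g : {linear tensor -> V}) :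
  (forall I, f (w I) = g (w I)) -> f =1 g.
Proof.
move=> h v; rewrite [v]tensor_basis !linear_sum; apply: eq_bigr => I _ /=.
by rewrite !linearZ /= h.
Qed.

Fact sum_coeff_linear (V : lmodType F) (f : sq -> V) :
  linear (fun v : tensor => \sum_I v I *: f I).
Proof.
move=> c u v; rewrite scaler_sumr -big_split; apply: eq_bigr => I _ /=.
by rewrite !ffunE scalerDl scalerA.
Qed.

Lemma sum_coeff_basis (V : lmodType F) (f : sq -> V) I :
  \sum_J w I J *: f J = f I.
Proof.
rewrite (bigD1 I) //= big1 ?addr0 => [|J /negPf nJ]; rewrite ffunE ?eqxx ?scale1r //.
by rewrite nJ scale0r.
Qed.

Fact rho_is_linear s : linear (@rho F p q n s).
Proof. exact: sum_coeff_linear. Qed.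
HB.instance Definition _ s :=
  GRing.isLinear.Build F tensor tensor _ (@rho F p q n s) (rho_is_linear s).

Fact glact_is_linear a b : linear (@glact F p q n a b).
Proof. exact: sum_coeff_linear. Qed.
HB.instance Definition _ a b :=
  GRing.isLinear.Build F tensor tensor _ (@glact F p q n a b) (glact_is_linear a b).

Definition rhoL s : {linear tensor -> tensor} := @rho F p q n s.

Lemma rho_basis s I : rho s (w I) = koszul (fun x => par (I x)) s *: w (pact s I).
Proof. by rewrite /rho sum_coeff_basis ksignE. Qed.

Lemma rhoL_act : is_act rhoL.
Proof.
split=> [|s t].
  apply: (linear_basis_eq (f := rhoL 1%g) (g := idfun)) => I; rewrite /= rho_basis pact1.
  by rewrite koszul_eq1 ?scale1r // => x y; rewrite !perm1.
apply: (linear_basis_eq (f := rhoL (s * t)%g) (g := rhoL t \o rhoL s)) => I.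
rewrite /= rho_basis rho_basis linearZ /= rho_basis scalerA koszulM pactM.
congr (_ * _ *: _); apply: eq_bigr => x _; apply: eq_bigr => y _.
by rewrite !ffunE.
Qed.

Lemma glact_basis a b I : glact a b (w I) = \sum_(r : 'I_n | I r == b)
  (\prod_(x : 'I_n) (-1) ^+ [&& par a (+) par b, (x < r)%N & par (I x)]) *: w (upd I r a).
Proof.
rewrite /glact sum_coeff_basis; apply: eq_bigr => r _; congr (_ *: _).
case: (_ (+) _); last by rewrite mul0n big1.
rewrite mul1n -prodr_const big_mkcond /=; apply: eq_bigr => x _.
by rewrite inE; case: ifP.
Qed.

Lemma rho_glact s a b v : rho s (glact a b v) = glact a b (rho s v).
Proof.
apply: (linear_basis_eq (f := rhoL s \o @glact F p q n a b)
  (g := @glact F p q n a b \o rhoL s)) => I {v}.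
rewrite /= glact_basis rho_basis linearZ /= glact_basis linear_sum scaler_sumr.
rewrite [RHS](reindex_inj (@perm_inj _ s)); apply: eq_big => [r|r /eqP Ir]; first by rewrite pactE.
rewrite linearZ /= rho_basis !scalerA.
have -> : pact s (upd I r a) = upd (pact s I) (s r) a.
  apply/ffunP => x; rewrite -[x](permKV s); move: (s^-1 x)%g => {}x.
  by rewrite !ffunE permK (inj_eq perm_inj).
congr (_ *: _); set dl := par a (+) par b.
have E1 : \prod_(x : 'I_n) (-1) ^+ [&& dl, (x < s r)%N & par (pact s I x)] =
          \prod_(x : 'I_n) (-1) ^+ [&& dl, (s x < s r)%N & par (I x)] :> F.
  by rewrite (reindex_inj (@perm_inj _ s)); apply: eq_bigr => x _; rewrite pactE.
pose g x : F := (-1) ^+ [&& inverted s x r, dl & par (I x)].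
(* Changing the entry at [r] alters the Koszul sign only in pairs with [r]: an inversion with an odd
   entry counts when the elementary matrix is odd. The same inversions measure how [s] changes the
   set of positions before [r]. *)
have E2 : koszul (fun x => par (upd I r a x)) s =
    koszul (fun x => par (I x)) s * \prod_(y | y != r) g y.
  rewrite -prod_pairs_at -big_split; apply: eq_bigr => x _ /=.
  rewrite -big_split; apply: eq_bigr => y lt /=; rewrite !ffunE /g.
  have nyx : y != x by apply/eqP => e; move: lt; rewrite e ltnn.
  have [xr|nx] := eqVneq x r.
    subst x; rewrite (negPf nyx) mulr1 Ir [inverted s y r]invertedC // -signr_addb /dl.
    by case: (inverted _ _ _); case: (par a); case: (par b); case: (par (I y)).
  have [yr|ny] := eqVneq y r; last by rewrite !mulr1.
  subst y; rewrite mul1r Ir -signr_addb /dl.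
  by case: (inverted _ _ _); case: (par a); case: (par b); case: (par (I x)).
rewrite E1 E2 mulrC -mulrA; congr (_ * _).
have -> : \prod_(y | y != r) g y = \prod_y g y.
  by rewrite [RHS](bigD1 r) //= {2}/g /inverted !ltnn mul1r.
rewrite -big_split; apply: eq_bigr => x _ /=; rewrite /g -signr_addb /inverted.
by case: (dl); case: (x < r)%N; case: (s x < s r)%N; case: (par (I x)).
Qed.

(** The pair of [x] and [y] contributes -1. For any other odd [z] the inversions with [x] and with
    [y] occur together and cancel. *)
Lemma koszul_tperm I x y : x != y -> I x = I y -> par (I x) ->
  koszul (fun z => par (I z)) (tperm x y) = -1.
Proof.
move=> nxy Ixy ox; set O := fun z => _; set u := tperm x y.
have Oy : O y by rewrite /O -Ixy.
pose c z : F := (-1) ^+ (inverted u z x && O z).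
(* The value 1 at [x] keeps the pair of [x] and [y] from being counted twice. *)
pose c' z : F := if z == x then 1 else (-1) ^+ (inverted u z y && O z).
have -> : koszul O u = (\prod_(z | z != x) c z) * (\prod_(z | z != y) c' z).
  rewrite -!prod_pairs_at -big_split; apply: eq_bigr => i _ /=.
  rewrite -big_split; apply: eq_bigr => j lt /=; rewrite /c' /c.
  have nji : j != i by apply/eqP => e; move: lt; rewrite e ltnn.
  have [ix|ni] := eqVneq i x.
    subst i; rewrite (negPf nji) (negPf nxy) [inverted u j x]invertedC // [O x]ox.
    by case: ifP; rewrite !mulr1.
  have [jx|nj] := eqVneq j x.
    by subst j; rewrite (negPf nxy) [O x]ox andbT; case: ifP; rewrite mul1r !mulr1.
  have [iy|niy] := eqVneq i y.
    subst i; rewrite Oy (negPf nji) [inverted u j y]invertedC //= !mul1r mulr1 //.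
  have [jy|njy] := eqVneq j y; first by subst j; rewrite Oy andbT !mul1r.
  by rewrite /inverted !tpermD ?addbb ?mulr1 // eq_sym.
rewrite (bigD1 y) 1?eq_sym //= [X in _ * X](bigD1 x) //=.
rewrite [c' x]/c' eqxx mul1r -mulrA.
rewrite [X in _ * (_ * X)](eq_bigl (fun z => (z != x) && (z != y))); last by move=> z; rewrite andbC.
rewrite -big_split /= big1 ?mulr1.
  rewrite /c Oy /inverted tpermL tpermR.
  have : x != y :> nat by [].
  by case: ltngtP.
move=> z /andP[zx zy]; rewrite /c /c' (negPf zx) /inverted tpermL tpermR tpermD 1?eq_sym //.
by rewrite [(z < y)%N (+) _]addbC -signr_addb addbb.
Qed.

End KoszulAction.

Arguments rhoL {F p q n} s.

(** * Straightening *)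

Section Rearrangement.
Variables (p q n : nat) (cls wt : 'I_n -> nat).
Local Notation sq := (seqT p q n).
Implicit Types (I J : sq) (s t : 'S_n).

(** With [wt] the column index it drives the straightening, with the row index the triangularity. *)
Definition wsum I : nat := (\sum_x wt x * I x)%N.

Definition sorted_on I : Prop :=
  forall x y, cls x = cls y -> (wt x < wt y)%N -> (I x <= I y)%N.

Lemma wsum_tperm I x y : (wt x < wt y)%N -> (I y < I x)%N ->
  (wsum I < wsum (pact (tperm x y) I))%N.
Proof.
move=> wxy Ixy; have nyx : y != x by apply/eqP => e; move: wxy; rewrite e ltnn.
rewrite /wsum (bigD1 x) // [X in (_ < X)%N](bigD1 x) //=.
rewrite (bigD1 y) // [X in (_ < _ + X)%N](bigD1 y) //=.
rewrite !ffunE tpermV tpermL tpermR.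
rewrite [X in (_ < _ + (_ + X))%N](eq_bigr (fun i => wt i * I i)%N); last first.
  by move=> i /andP[ix iy]; rewrite ffunE tpermV tpermD // eq_sym.
rewrite !addnA ltn_add2r; move: (wt x) (wt y) (nat_of_ord (I x)) (nat_of_ord (I y)) wxy Ixy.
by move=> c1 c2 i1 i2 h1 h2; nia.
Qed.

Definition is_wsum_max I t :=
  t \in stab cls /\ forall s, s \in stab cls -> (wsum (pact s I) <= wsum (pact t I))%N.

Lemma wsum_max_exists I : exists t, is_wsum_max I t.
Proof.
have i1 : (1%g : 'S_n) \in stab cls by exact: group1.
have [t tC tM] := arg_maxnP (fun s => wsum (pact s I)) i1.
by exists t.
Qed.

Lemma wsum_max_sorted I t : is_wsum_max I t -> sorted_on (pact t I).
Proof.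
case=> tC tM x y cxy wxy; rewrite leqNgt; apply/negP => lt.
have := tM (t * tperm x y)%g; rewrite groupM ?tperm_stab // => /(_ isT).
by rewrite pactM leqNgt wsum_tperm.
Qed.

Hypothesis wtI : forall x y, cls x = cls y -> wt x = wt y -> x = y.

Lemma sorted_on_uniq I s : s \in stab cls -> sorted_on I -> sorted_on (pact s I) -> pact s I = I.
Proof.
have key J t x : t \in stab cls -> sorted_on J -> sorted_on (pact t J) ->
    (forall y, cls y = cls x -> (wt y < wt x)%N -> pact t J y = J y) -> (pact t J x <= J x)%N.
  move=> tC Js ts ag; rewrite leqNgt; apply/negP => lt.
  (* Agreement before [x] and sortedness leave strictly fewer entries of the class at most [J x]
     after rearrangement, yet a permutation preserves their number. *)
  have : (#|[set y | (cls y == cls x) && (pact t J y <= J x)%N]| <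
          #|[set y | (cls y == cls x) && (J y <= J x)%N]|)%N.
    apply: proper_card; apply/properP; split.
      apply/subsetP => y; rewrite !inE => /andP[/eqP cy hy]; rewrite cy eqxx /=.
      case: (ltngtP (wt y) (wt x)) => h; first by rewrite -ag.
        have := ts x y (esym cy) h; rewrite leqNgt => /negP[].
        exact: leq_ltn_trans hy lt.
      by rewrite (wtI cy h).
    by exists x; rewrite !inE eqxx //= -ltnNge.
  suff -> : [set y | (cls y == cls x) && (pact t J y <= J x)%N] =
     t @: [set y | (cls y == cls x) && (J y <= J x)%N].
    by rewrite card_imset ?ltnn //; exact: perm_inj.
  apply/setP => y; rewrite -[y](permKV t); move: (t^-1 y)%g => {}y.
  by rewrite mem_imset ?inE ?pactE ?(stabP _ _ tC) //; exact: perm_inj.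
move=> sC Is ss; apply/ffunP => x.
have [N] := ubnP (wt x); elim: N x => // N IH x; rewrite ltnS => ltN.
have ag y : cls y = cls x -> (wt y < wt x)%N -> pact s I y = I y.
  by move=> _ h; apply: IH; apply: leq_trans h ltN.
apply/eqP; rewrite -(inj_eq val_inj) /= eqn_leq key //=.
have sV : pact s^-1%g (pact s I) = I by rewrite -pactM mulgV pact1.
rewrite -{1}sV; apply: key; rewrite ?groupV ?sV // => y c h; by rewrite ag.
Qed.

(** A maximizer of [wsum] in the orbit is sorted, hence equals [I] by uniqueness; the same argument
    settles the equality case. *)
Lemma wsum_rearrange I s : s \in stab cls -> sorted_on I ->
  (wsum (pact s I) <= wsum I)%N /\ (wsum I <= wsum (pact s I) -> pact s I = I)%N.
Proof.
move=> sC Is; have [t tM] := wsum_max_exists I; have [tC tm] := tM.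
have e : pact t I = I by apply: sorted_on_uniq => //; exact: wsum_max_sorted.
rewrite e in tm; split=> [|le]; first exact: tm.
apply: sorted_on_uniq => //; apply: wsum_max_sorted; split=> // u uC.
exact: leq_trans (tm _ uC) le.
Qed.

End Rearrangement.

Section Straightening.
Variables (F : fieldType) (p q n : nat) (row col : 'I_n -> nat).
Hypothesis HF : [pchar F] =i pred0.
Hypothesis sh : is_shape row col.
Local Notation sq := (seqT p q n).
Local Notation tensor := (tensorT F p q n).
Local Notation w := (@basisv F p q n).
Local Notation R := (stab row).
Local Notation C := (stab col).
Local Notation a := (symz (@rhoL F p q n) R).
Local Notation b := (altz (@rhoL F p q n) C).
Implicit Types (I J : sq) (s t g : 'S_n).

Let actP := @rhoL_act F p q n.
Let tf2 : forall v : tensor, v + v = 0 -> v = 0 := torsion2_free (@torsion_free _ HF tensor).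

Definition sst I : Prop :=
  (forall x y, row x = row y -> (col x < col y)%N ->
     (I x <= I y)%N && ((I x == I y) ==> ~~ par (I x))) /\
  (forall x y, col x = col y -> (row x < row y)%N ->
     (I x <= I y)%N && ((I x == I y) ==> par (I x))).

Lemma pact_tperm I x y : I x = I y -> pact (tperm x y) I = I.
Proof. by move=> e; apply/ffunP => z; rewrite ffunE tpermV; case: tpermP => [->|->|]. Qed.

Lemma rho_odd_tperm I x y : x != y -> I x = I y -> par (I x) ->
  rhoL (tperm x y) (w I) = - w I.
Proof. by move=> nxy e o; rewrite /= rho_basis koszul_tperm // pact_tperm // scaleN1r. Qed.

Lemma rho_even_fix I s : pact s I = I -> (forall x, s x != x -> ~~ par (I x)) ->
  rhoL s (w I) = w I.
Proof.
move=> sI ev; rewrite /= rho_basis sI koszul_eq1 ?scale1r // => x y lt ox oy.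
have fx z : par (I z) -> s z = z by move=> oz; apply: contraTeq oz; exact: ev.
by rewrite !fx.
Qed.

(** If a point enters a finite class another one must leave it, since otherwise [g] permutes the
    class. *)
Lemma exists_compensating (f : 'I_n -> nat) g z : f (g z) != f z ->
  exists2 z', f z' = f (g z) & f (g z') != f z'.
Proof.
move=> nz; case: (pickP [pred y | (f y == f (g z)) && (f (g y) != f y)]) => [y|no].
  by case/andP=> /eqP ? ?; exists y.
pose A := [set y | f y == f (g z)].
have gA : g @: A = A.
  apply/eqP; rewrite eqEcard card_imset ?leqnn ?andbT; last exact: perm_inj.
  apply/subsetP => y /imsetP[x]; rewrite inE => /eqP xA ->; rewrite inE.
  by move: (no x); rewrite /= xA eqxx => /negbFE.
have : g z \in g @: A by rewrite gA inE.
rewrite mem_imset; last exact: perm_inj.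
by rewrite inE eq_sym (negPf nz).
Qed.

(* Exchanging two equal odd entries costs a sign in both characters, so a permutation whose
   class-changing points carry equal odd entries may be replaced by a class-preserving one. *)
Lemma odd_exchange (f : 'I_n -> nat) I g :
  (forall z z', f (g z) != f z -> f z' = f (g z) -> f (g z') != f z' ->
     par (I z) && (I z' == I z)) ->
  exists2 c, c \in stab f & (-1) ^+ g *: rhoL g (w I) = (-1) ^+ c *: rhoL c (w I).
Proof.
have [N] := ubnP #|[set z | f (g z) != f z]|; elim: N g => // N IH g; rewrite ltnS => ltN Q.
case: (pickP [pred z | f (g z) != f z]) => [z0 /= nz0|no]; last first.
  by exists g => //; apply/stabP => z; move: (no z) => /= /negbFE/eqP.
have [z' fz' nz'] := exists_compensating nz0.
have /andP[o0 /eqP e0] := Q _ _ nz0 fz' nz'.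
have n0' : z0 != z' by apply: contraNneq nz0 => e; rewrite -fz' e.
(* After the exchange [z'] stays in its class, so fewer points change class; the sign of the
   transposition cancels the Koszul sign. *)
pose g' := (tperm z0 z' * g)%g.
have g0 : g' z0 = g z' by rewrite permM tpermL.
have g1 : g' z' = g z0 by rewrite permM tpermR.
have gD z : z != z0 -> z != z' -> g' z = g z.
  by move=> h1 h2; rewrite permM tpermD // eq_sym.
have sub z : f (g' z) != f z -> (z != z') && (f (g z) != f z).
  have [->|zz'] := eqVneq z z'; first by rewrite g1 fz' eqxx.
  by have [->|zz0] := eqVneq z z0; [rewrite nz0|rewrite gD].
have [||c cf ec] := IH g'.
- apply: leq_trans ltN; apply: proper_card; apply/properP; split.
    by apply/subsetP => z; rewrite !inE => /sub/andP[].
  by exists z'; rewrite !inE // g1 fz' eqxx.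
- move=> z z2 h1 h2 h3; have /andP[zz' nz] := sub _ h1; have /andP[_ nz2] := sub _ h3.
  have [zz0|zz0] := eqVneq z z0.
    move: h2; rewrite zz0 g0 o0 => h2.
    by have /andP[_ /eqP ->] := Q _ _ nz' h2 nz2; rewrite e0 eqxx.
  by apply: Q; rewrite // -(gD z zz0 zz').
exists c; first exact: cf.
rewrite -ec; have -> : rhoL g' (w I) = - rhoL g (w I).
  by rewrite (actM actP) (rho_odd_tperm n0' (esym e0) o0) linearN.
by rewrite odd_permM odd_tperm n0' signrN scaleNr scalerN opprK.
Qed.

Lemma column_length r c : (exists y, row y = r /\ col y = c) <->
  (r < #|[set y | col y == c]|)%N.
Proof.
have [rcI rcD] := sh; split=> [[y [<- <-]]|lt].
  rewrite (row_rank y sh); apply: proper_card; apply/properP; split.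
    by apply/subsetP => z; rewrite !inE => /andP[].
  by exists y; rewrite !inE ?eqxx // ltnn andbF.
case: (pickP [pred y | (col y == c) && (r <= row y)%N]) => [y /andP[/eqP cy ry]|no].
  by apply: rcD ry _; rewrite cy.
move: lt; rewrite ltnNge => /negP[]; apply: (@card_le_inj _ _ row) => [y z|y]; rewrite !inE.
  by move=> /eqP cy /eqP cz rr; apply: rcI; rewrite // cy.
by move=> cy; move: (no y); rewrite /= cy /= leqNgt => /negbFE.
Qed.

(** * Garnir relations *)

Section Garnir.
Variables (x0 y0 : 'I_n).
Hypotheses (rxy : row x0 = row y0) (cxy : (col x0 < col y0)%N).

Definition below : pred 'I_n := fun z => (col z == col x0) && (row x0 <= row z)%N.
Definition above : pred 'I_n := fun z => (col z == col y0) && (row z <= row x0)%N.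
(* [stab garnir_class] is the symmetric group of the Garnir set. *)
Definition garnir_class (z : 'I_n) : nat := if below z || above z then n else z.

Lemma garnir_fix g z : g \in stab garnir_class -> ~~ (below z || above z) -> g z = z.
Proof.
move=> /stabP/(_ z); rewrite /garnir_class => e nz; move: e; rewrite (negPf nz).
by case: ifP => _ e; [have := ltn_ord z; rewrite -e ltnn|apply: val_inj].
Qed.

Lemma garnir_in g z : g \in stab garnir_class -> below z || above z ->
  below (g z) || above (g z).
Proof.
move=> /stabP/(_ z); rewrite /garnir_class => e zz; move: e; rewrite zz.
by case: ifP => // _ e; have := ltn_ord (g z); rewrite e ltnn.
Qed.

(** Pigeonhole: the Garnir set has more points than the left column has rows, and [t] keeps it
    within those rows. Two points sharing a row cannot share a column. *)
Lemma garnir_same_row t : t \in C ->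
  exists x y, [/\ below x, above y & row (t x) = row (t y)].
Proof.
move=> /stabP tC; have [rcI rcD] := sh.
case: (pickP [pred xy : 'I_n * 'I_n | [&& below xy.1, above xy.2 & row (t xy.1) == row (t xy.2)]]).
  by case=> x y /and3P[? ? /eqP ?]; exists x, y.
move=> no; exfalso; pose L := #|[set y | col y == col x0]|.
pose A := [set z | below z || above z].
have le : (#|A| <= L)%N.
  apply: (@card_le_inj _ _ (fun z => row (t z))) => [x y|x]; rewrite !inE.
    case/orP=> hx; case/orP=> hy e.
    - apply: (@perm_inj _ t); apply: rcI => //; rewrite !tC.
      by case/andP: hx => /eqP -> _; case/andP: hy => /eqP -> _.
    - by have := no (x, y); rewrite /= hx hy e eqxx.
    - by have := no (y, x); rewrite /= hx hy e eqxx.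
    - apply: (@perm_inj _ t); apply: rcI => //; rewrite !tC.
      by case/andP: hx => /eqP -> _; case/andP: hy => /eqP -> _.
  move=> hx; apply/column_length.
  apply: (rcD (t x)); rewrite // tC.
  by case/orP: hx => /andP[/eqP -> _] //; exact: ltnW.
have : (L.+1 <= #|A|)%N.
  (* Both parts meet the row of [x0]; shifting the left part down by one makes the values cover [0]
     to [L]. *)
  apply: (@card_ge_surj _ _ (fun z => if below z then (row z).+1 else row z)) => i iL.
  case: (leqP i (row x0)) => h.
    have [z [rz cz]] := rcD y0 i (col y0) ltac:(rewrite -rxy //) (leqnn _).
    have nb : below z = false by rewrite /below cz gtn_eqF.
    by exists z; rewrite ?inE nb //= /above cz rz eqxx.
  have [z [rz cz]] : exists z, row z = i.-1 /\ col z = col x0.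
    by apply/column_length; rewrite -/L; case: i iL h.
  have bz : below z by rewrite /below cz rz eqxx; case: i iL h rz.
  by exists z; rewrite ?inE bz // rz prednK //; exact: leq_ltn_trans h.
by rewrite ltnNge le.
Qed.

(** For each [t] the two points of [garnir_same_row] lie in one Garnir class and are sent to one
    row, so [symz_altz_eq0] applies. *)
Lemma garnir_eq0 v : a (b (altz (@rhoL F p q n) (stab garnir_class) v)) = 0.
Proof.
rewrite {2}/altz linear_sum big1 // => t tC; rewrite linearZ /=.
have [x [y [hx hy e]]] := garnir_same_row tC.
have nxy : x != y.
  apply: contraTneq cxy => exy; case/andP: hx => /eqP <- _; case/andP: hy => /eqP <- _.
  by rewrite exy ltnn.
suff -> : a (rhoL t (altz (@rhoL F p q n) (stab garnir_class) v)) = 0 by rewrite scaler0.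
apply: (@symz_altz_eq0 _ _ _ _ actP tf2 row garnir_class t v (t x) (t y)) => //.
  by rewrite (inj_eq perm_inj).
by rewrite !permK /garnir_class hx hy orbT.
Qed.

Section Step.
Variable I : sq.
Hypothesis colsorted : sorted_on col row I.
Hypothesis viol : (I y0 <= I x0)%N /\ (I x0 = I y0 -> par (I x0)).

Lemma below_ge z : below z -> (I x0 <= I z)%N.
Proof.
case/andP=> /eqP cz; rewrite leq_eqVlt => /orP[/eqP r|lt].
  by have [rcI _] := sh; rewrite (rcI x0 z).
exact: colsorted lt.
Qed.

Lemma above_le z : above z -> (I z <= I y0)%N.
Proof.
case/andP=> /eqP cz; rewrite rxy leq_eqVlt => /orP[/eqP r|lt].
  by have [rcI _] := sh; rewrite (rcI z y0).
exact: colsorted lt.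
Qed.

Lemma wsum_pact g : wsum col (pact g I) = (\sum_x col (g x) * I x)%N.
Proof.
rewrite /wsum (reindex_inj (@perm_inj _ g)); apply: eq_bigr => x _.
by rewrite pactE.
Qed.

(** In subtraction-free form: moving [z] by [g] does not decrease column times [I z - I x0]. Left
    entries are at least [I x0] and can only move right; right entries are at most [I x0] and can
    only move left. *)
Lemma garnir_term g z : g \in stab garnir_class ->
  (col z * I z + col (g z) * I x0 <= col (g z) * I z + col z * I x0)%N /\
  ((col (g z) * I z + col z * I x0 <= col z * I z + col (g z) * I x0)%N ->
    col (g z) != col z -> I z = I x0).
Proof.
move=> gG; case: (boolP (below z || above z)) => [zz|nz]; last first.
  by rewrite garnir_fix // eqxx.
have cg : (col x0 <= col (g z) <= col y0)%N.
  by case/orP: (garnir_in gG zz) => /andP[/eqP -> _]; rewrite leqnn ltnW.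
case/orP: zz => zz.
  have := below_ge zz; case/andP: zz => /eqP -> _; case/andP: cg.
  move: (col x0) (col (g z)) => c1 c2 h _ iz; split; first by nia.
  by move=> h1 h2; apply: val_inj => /=; nia.
have := leq_trans (above_le zz) viol.1; case/andP: zz => /eqP -> _; case/andP: cg.
move: (col y0) (col (g z)) => c1 c2 _ h iz; split; first by nia.
by move=> h1 h2; apply: val_inj => /=; nia.
Qed.

(** Summing [garnir_term], the parts in [I x0] cancel. In case of equality all points changing
    column carry one odd entry, and [odd_exchange] replaces [g] by a column permutation. *)
Lemma garnir_wsum g : g \in stab garnir_class ->
  (wsum col I <= wsum col (pact g I))%N /\
  (wsum col (pact g I) = wsum col I ->
     a (b ((-1) ^+ g *: rhoL g (w I))) = a (b (w I))).
Proof.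
move=> gG; rewrite wsum_pact.
have E : (\sum_x col (g x) * I x0 = \sum_x col x * I x0)%N.
  by rewrite -!big_distrl sum_perm.
have S1 : (\sum_x (col x * I x + col (g x) * I x0) <=
          \sum_x (col (g x) * I x + col x * I x0))%N.
  by apply: leq_sum => x _; exact: (garnir_term x gG).1.
split; first by move: S1; rewrite !big_split /= E leq_add2r.
move=> e.
have eqt z : (col (g z) * I z + col z * I x0 <= col z * I z + col (g z) * I x0)%N.
  rewrite leqNgt; apply/negP => lt.
  suff : (\sum_x (col x * I x + col (g x) * I x0) <
          \sum_x (col (g x) * I x + col x * I x0))%N.
    by rewrite !big_split /= E e /wsum ltnn.
  rewrite (bigD1 z) // [X in (_ < X)%N](bigD1 z) //= -addSn leq_add //.
  by apply: leq_sum => x _; exact: (garnir_term x gG).1.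
have ch z : col (g z) != col z -> I z = I x0 := (garnir_term z gG).2 (eqt z).
have inZ z : col (g z) != col z -> below z || above z.
  by apply: contraNT => nz; rewrite garnir_fix.
have [z z' n1 h n2|c cC ->] := @odd_exchange col I g.
  rewrite (ch z') // (ch z) // eqxx andbT; apply: viol.2; apply: val_inj => /=.
  apply/eqP; rewrite eqn_leq viol.1 andbT.
  (* A moved point of the right column carries [I x0], so [I x0] is at most [I y0]; the violation
     then makes them equal and odd. *)
  have [u nu au] : exists2 u, col (g u) != col u & above u.
    case/orP: (inZ z n1) => hz; last by exists z.
    case/orP: (inZ z' n2) => hz'; last by exists z'.
    case/negP: n1; rewrite -h.
    by case/andP: hz => /eqP -> _; case/andP: hz' => /eqP -> _.
  by rewrite -(ch u nu) above_le.
by rewrite !linearZ /= altz_act // linearZ /= scalerA -signr_addb addbb scale1r.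
Qed.

(** In the Garnir relation the terms of unchanged [wsum] all equal [a (b (w I))], and their number
    is invertible; the other terms have larger [wsum]. *)
Lemma straighten_step (U : {vspace tensor}) :
  (forall J, (wsum col I < wsum col J)%N -> a (b (w J)) \in U) -> a (b (w I)) \in U.
Proof.
move=> hU.
have : \sum_(g in stab garnir_class) a (b ((-1) ^+ g *: rhoL g (w I))) = 0.
  by rewrite -[RHS](garnir_eq0 (w I)) -(linear_sum a) -(linear_sum b).
rewrite (bigID (fun g => wsum col (pact g I) == wsum col I)) /=.
rewrite (eq_bigr (fun _ => a (b (w I)))) => [|g /andP[gG /eqP e]]; last first.
  exact: (garnir_wsum gG).2.
rewrite sumr_const -scaler_nat; set N := #|_|; set v := \sum_(_ in _ | _) _ => e0.
have N0 : N%:R != 0 :> F.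
  apply: natr_neq0_char0 => //; apply/card_gt0P; exists 1%g.
  by rewrite unfold_in /= group1 pact1 eqxx.
rewrite -[a (b (w I))](scalerK N0) rpredZ // -[_ *: _](addrK v) e0 sub0r rpredN.
apply: memv_suml => g /andP[gG ne]; rewrite !linearZ /= rpredZ // rho_basis !linearZ /= rpredZ //.
by apply: hU; rewrite ltn_neqAle eq_sym ne (garnir_wsum gG).1.
Qed.

End Step.
End Garnir.

Lemma koszul_sign I s : exists e : bool, koszul F (fun x => par (I x)) s = (-1) ^+ e.
Proof. by rewrite -ksignE /ksign -signr_odd; eexists. Qed.

(** Induction on the distance of [wsum] from its bound. Sorting the columns changes only a sign, a
    repeated even entry in a column gives 0, and a row violation is removed by [straighten_step]. *)
Lemma straighten (U : {vspace tensor}) :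
  (forall J, sst J -> a (b (w J)) \in U) -> forall I, a (b (w I)) \in U.
Proof.
move=> hU I; pose B := (\sum_(x : 'I_n) col x * (p + q))%N.
have leB J : (wsum col J <= B)%N.
  by apply: leq_sum => x _; rewrite leq_mul2l (ltnW (ltn_ord (J x))) orbT.
have [N] := ubnP (B - wsum col I)%N; elim: N I => // N IH I; rewrite ltnS => ltN.
have rI x y : col x = col y -> row x = row y -> x = y by move=> h1 h2; apply: sh.1.
have [t tM] := wsum_max_exists col row I; have [tC _] := tM.
have js := wsum_max_sorted tM; set J := pact t I in js.
have wJ : wsum col J = wsum col I.
  by rewrite wsum_pact; apply: eq_bigr => x _; rewrite (stabP _ _ tC).
suff hJ : a (b (w J)) \in U.
  have := altz_act actP (w I) tC; rewrite /= rho_basis -/J.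
  have [e ->] := koszul_sign I t; move/(congr1 (fun v => (-1) ^+ t *: a v)).
  rewrite !linearZ /= [X in _ = X]scalerA -signr_addb addbb scale1r => <-.
  by rewrite !rpredZ.
have IHJ K : (wsum col J < wsum col K)%N -> a (b (w K)) \in U.
  move=> lt; apply: IH; apply: leq_trans ltN; rewrite -wJ; apply: ltn_sub2l => //.
  exact: leq_trans lt (leB K).
case: (pickP [pred xy : 'I_n * 'I_n | [&& col xy.1 == col xy.2, (row xy.1 < row xy.2)%N,
    J xy.1 == J xy.2 & ~~ par (J xy.1)]]) => [[x y] /and4P[/= /eqP cx rx /eqP Jx ev]|no1].
  have nxy : x != y by apply: contraTneq rx => ->; rewrite ltnn.
  have bJ : b (w J) = 0.
    apply: tf2; rewrite -{1}(@rho_even_fix J (tperm x y)); first 1 last.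
    - exact: pact_tperm.
    - by move=> z; case: tpermP => [->|->|]; rewrite ?eqxx // -Jx.
    rewrite (altz_act actP _ (tperm_stab cx)) odd_tperm nxy expr1 scaleN1r addNr //.
  by rewrite bJ linear0 mem0v.
case: (pickP [pred xy : 'I_n * 'I_n | [&& row xy.1 == row xy.2, (col xy.1 < col xy.2)%N &
    ~~ ((J xy.1 <= J xy.2)%N && ((J xy.1 == J xy.2) ==> ~~ par (J xy.1)))]])
    => [[x y] /and3P[/= /eqP rx cx vi]|no2].
  apply: (straighten_step rx cx js _ IHJ); move: vi.
  rewrite negb_and -ltnNge negb_imply negbK => /orP[lt|/andP[/eqP -> o]]; last by [].
  by split=> [|e]; [exact: ltnW|move: lt; rewrite e ltnn].
apply: hU; split=> x y h1 h2.
  by have := no2 (x, y); rewrite /= h1 eqxx h2 /= => /negbFE.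
rewrite js //=; apply/implyP => e; have := no1 (x, y).
by rewrite /= h1 eqxx h2 e /= => /negbFE.
Qed.

(** * Triangularity of the semistandard vectors *)

Section Independence.
Variables (I J : sq).
Hypotheses (sI : sst I) (sJ : sst J).

Lemma sst_colsorted (K : sq) : sst K -> sorted_on col row K.
Proof. by case=> _ h x y c r; case/andP: (h x y c r). Qed.

Lemma sst_rowsorted (K : sq) : sst K -> sorted_on row col K.
Proof. by case=> h _ x y c r; case/andP: (h x y c r). Qed.

Let cI x y : col x = col y -> row x = row y -> x = y.
Proof. by move=> h1 h2; apply: sh.1. Qed.

Lemma young_coef (K : sq) : a (b (w I)) K = \sum_(s in R) \sum_(t in C)
  ((-1) ^+ t *: rhoL s (rhoL t (w I)) : tensor) K.
Proof.
rewrite {1}/symz sum_ffunE; apply: eq_bigr => s _.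
by rewrite linear_sum sum_ffunE; apply: eq_bigr => t _; rewrite linearZ.
Qed.

Lemma rho2_coef s t (K : sq) : K <> pact s (pact t I) ->
  (rhoL s (rhoL t (w I)) : tensor) K = 0.
Proof.
move=> /eqP ne; rewrite /= rho_basis linearZ /= rho_basis scalerA !ffunE (negPf ne).
exact: mulr0.
Qed.

Lemma wsum_row_pact s : s \in R -> forall K : sq, wsum row (pact s K) = wsum row K.
Proof.
move=> /stabP sR K; rewrite /wsum (reindex_inj (@perm_inj _ s)); apply: eq_bigr => x _.
by rewrite pactE sR.
Qed.

Lemma wsum_row_rearranged s t : s \in R -> t \in C ->
  (wsum row I <= wsum row (pact s (pact t I)))%N -> pact t I = I.
Proof.
move=> sR tC; rewrite wsum_row_pact // => le.
exact: (wsum_rearrange cI tC (sst_colsorted sI)).2.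
Qed.

(** A contributing term has [J] obtained from [I] by [t] and then [s]. Row permutations keep the row
    weight, and by the rearrangement inequality [t] must fix [I]; then both sequences have sorted
    rows and coincide. *)
Lemma young_coef_eq0 : J != I -> (wsum row I <= wsum row J)%N -> a (b (w I)) J = 0.
Proof.
move=> nJI le; rewrite young_coef big1 // => s sR; rewrite big1 // => t tC.
rewrite ffunE rho2_coef ?[LHS]mulr0 // => e.
have tI : pact t I = I by apply: (wsum_row_rearranged sR tC); rewrite -e.
case/eqP: nJI; rewrite e tI; apply: (sorted_on_uniq (cls := row) (wt := col)) => //.
- by move=> x y h1 h2; apply: sh.1.
- exact: sst_rowsorted.
- by rewrite -[in X in sorted_on _ _ X]tI -e; exact: sst_rowsorted.
Qed.

(** Equal entries in a column are odd, so the two signs cancel: [odd_exchange] with singleton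
    classes replaces [t] by the identity. *)
Lemma rho_column_fix t : t \in C -> pact t I = I -> (-1) ^+ t *: rhoL t (w I) = w I.
Proof.
move=> tC tI; have [z z' n1 h n2|c /stabP cC ->] := @odd_exchange val I t.
  move/val_inj: h => ->; have It : I (t z) = I z by rewrite -{1}tI pactE.
  rewrite It eqxx andbT.
  have cz : col (t z) = col z by exact: (stabP _ _ tC).
  have ntz : t z != z by rewrite -(inj_eq val_inj).
  have := sI.2; case: (ltngtP (row (t z)) (row z)) => r hc.
  - by have /andP[_ /implyP] := hc _ _ cz r; rewrite It eqxx => /(_ isT).
  - by have /andP[_ /implyP] := hc _ _ (esym cz) r; rewrite It eqxx => /(_ isT).
  - by case/eqP: ntz; apply: cI.
have -> : c = 1%g by apply/permP => z; rewrite perm1; apply: val_inj; exact: cC.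
by rewrite odd_perm1 scale1r act1.
Qed.

Lemma rho_row_fix s : s \in R -> pact s I = I -> rhoL s (w I) = w I.
Proof.
move=> sR eI; apply: rho_even_fix => // z nz.
have Is : I (s z) = I z by rewrite -{1}eI pactE.
have rz : row (s z) = row z by exact: (stabP _ _ sR).
have := sI.1; case: (ltngtP (col (s z)) (col z)) => c hr.
- by have /andP[_ /implyP] := hr _ _ rz c; rewrite Is eqxx => /(_ isT).
- by have /andP[_ /implyP] := hr _ _ (esym rz) c; rewrite Is eqxx => /(_ isT).
- by case/eqP: nz; apply: cI.
Qed.

(** The coefficient counts the pairs of a column and a row permutation that both fix [I]. *)
Lemma young_coef_neq0 : a (b (w I)) I != 0.
Proof.
rewrite young_coef.
have -> : \sum_(s in R) \sum_(t in C) ((-1) ^+ t *: rhoL s (rhoL t (w I)) : tensor) I =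
   \sum_(s in R) \sum_(t in C) ((pact t I == I) && (pact s I == I))%:R.
  apply: eq_bigr => s sR; apply: eq_bigr => t tC.
  case: eqP => [tI|ntI] /=; last first.
    rewrite ffunE rho2_coef ?[LHS]mulr0 // => e; apply: ntI.
    by apply: (wsum_row_rearranged sR tC); rewrite -e.
  rewrite -linearZ /= rho_column_fix //; case: eqP => [eI|neI].
    by rewrite rho_row_fix // ffunE eqxx.
  by rewrite rho_basis ffunE ffunE; case: eqP => [e|_]; [case: neI|exact: mulr0].
under eq_bigr do rewrite -natr_sum; rewrite -natr_sum; apply: natr_neq0_char0 => //.
by rewrite (bigD1 1%g) ?group1 //= (bigD1 1%g) ?group1 //= !pact1 eqxx.
Qed.

End Independence.

Lemma sst_independent (P : pred sq) (c : sq -> F) : (forall I, P I -> sst I) ->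
  \sum_(I | P I) c I *: a (b (w I)) = 0 -> forall I, P I -> c I = 0.
Proof.
move=> Ps s0 I PI; apply/eqP; apply: contraT => cI.
pose Q := [pred K | P K && (c K != 0)].
have QI : Q I by rewrite /= PI.
have [J /andP[PJ cJ] Jmax] := arg_maxnP (wsum row) QI.
move/ffunP/(_ J): s0; rewrite sum_ffunE (bigD1 J) //= big1 ?addr0.
  rewrite !ffunE => /eqP; rewrite mulf_eq0 (negPf cJ) (negPf (young_coef_neq0 _)) //.
  exact: Ps.
move=> K /andP[PK KJ]; have [->|cK] := eqVneq (c K) 0; first by rewrite scale0r ffunE.
rewrite ffunE young_coef_eq0 ?[LHS]mulr0 //; [exact: Ps|exact: Ps|by rewrite eq_sym|].
by apply: Jmax; rewrite /= PK.
Qed.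

End Straightening.

(** * The decomposition *)

Section Plethysm.
Variables (F : fieldType) (p q k : nat).
Hypothesis HF : [pchar F] =i pred0.
Local Notation n := k.*2.
Local Notation tensor := (tensorT F p q n).
Local Notation w := (@basisv F p q n).
Local Notation rL := (@rhoL F p q n).
Local Notation e := (symz rL (Hk k)).
Local Notation a l := (symz rL (Rt l)).
Local Notation b l := (altz rL (Ct l)).
Implicit Types (l : ptn n) (I J : seqT p q n) (v : tensor).

Let actP := @rhoL_act F p q n.

Lemma youngE l v : young l v = a l (b l v).
Proof.
rewrite /young exchange_big; apply: eq_bigr => s _.
rewrite (linear_sum (rL s)); apply: eq_bigr => t _.
by rewrite linearZ -(actM actP).
Qed.

Lemma PfE l I : Pf F l I = e (a l (b l (w I))).
Proof.
rewrite -youngE /Pf /young (linear_sum e); apply: eq_bigr => t _.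
rewrite (linear_sum e); apply: eq_bigr => s _.
by rewrite linearZ /= rho_basis linearZ /= ksignE scalerA.
Qed.

Lemma sum_lines_basis (f : {linear tensor -> tensor}) :
  (\sum_I <[f (w I)]>)%VS = limg (linfun f).
Proof.
apply: subv_anti; apply/andP; split.
  apply/subv_sumP => I _; rewrite -memvE; apply/memv_imgP.
  by exists (w I); rewrite ?memvf // lfunE.
apply/subvP => _ /memv_imgP[v _ ->]; rewrite lfunE /= [v]tensor_basis linear_sum.
apply: memv_suml => I _; rewrite linearZ rpredZ //.
by rewrite memvE (sumv_sup I).
Qed.

Lemma mem_Wlam l v : reflect (exists u, v = a l (b l u)) (v \in Wlam F p q l).
Proof.
have -> : Wlam F p q l = limg (linfun (a l \o b l)).
  rewrite -sum_lines_basis; apply: eq_bigr => I _; by rewrite youngE.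
apply: (iffP memv_imgP) => [[u _ ->]|[u ->]]; exists u; rewrite ?memvf ?lfunE //.
Qed.

Lemma mem_SkS2 v : reflect (exists u, v = e u) (v \in SkS2 F p q k).
Proof.
have -> : SkS2 F p q k = limg (linfun e) by rewrite -sum_lines_basis.
apply: (iffP memv_imgP) => [[u _ ->]|[u ->]]; exists u; rewrite ?memvf ?lfunE //.
Qed.

Definition pf_component l : {vspace tensor} := (linfun e @: Wlam F p q l)%VS.

Lemma mem_pf_component l v :
  reflect (exists u, v = e (a l (b l u))) (v \in pf_component l).
Proof.
apply: (iffP memv_imgP) => [[_ /mem_Wlam[u ->] ->]|[u ->]]; first by exists u; rewrite lfunE.
by exists (a l (b l u)); rewrite ?lfunE //; apply/mem_Wlam; exists u.
Qed.

Lemma glact_symz i j A v : glact i j (symz rL A v) = symz rL A (glact i j v).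
Proof.
by rewrite /symz (linear_sum (@glact F p q n i j)); apply: eq_bigr => s _; rewrite /= rho_glact.
Qed.

Lemma glact_altz i j A v : glact i j (altz rL A v) = altz rL A (glact i j v).
Proof.
rewrite /altz (linear_sum (@glact F p q n i j)); apply: eq_bigr => s _.
by rewrite linearZ /= rho_glact.
Qed.

Lemma pf_component_stable l : gl_stable (pf_component l).
Proof.
move=> i j v /mem_pf_component[u ->]; apply/mem_pf_component; exists (glact i j u).
by rewrite !glact_symz glact_altz.
Qed.

Lemma pf_components_span : (\sum_(l | is_evpart l) pf_component l)%VS = SkS2 F p q k.
Proof.
apply: subv_anti; apply/andP; split.
  apply/subv_sumP => l _; apply/subvP => v /mem_pf_component[u ->].
  by apply/mem_SkS2; eexists.
apply/subvP => _ /mem_SkS2[u ->].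
have [c ->] := symz_pf_decomposition HF actP; apply: memv_sumr => l _.
by apply: rpredZ; apply/mem_pf_component; eexists.
Qed.

Lemma evpart_part l : is_evpart l -> is_part l.
Proof. by case/andP. Qed.

Lemma evpart_shape l : is_evpart l -> is_shape (row_of l) (col_of l).
Proof. by move/evpart_part; exact: part_shape. Qed.

Lemma evpart_rowI l m (s : 'S_n) : is_evpart l -> is_evpart m ->
  (forall x, row_of l (s x) = row_of m x) -> l = m.
Proof. by move=> /evpart_part lp /evpart_part mp; exact: row_of_inj. Qed.

Lemma pf_components_direct : directv (\sum_(l | is_evpart l) pf_component l).
Proof.
apply/directv_sum_independent => u uM u0 l le.
have [|v vP] := @fin_all_exists _ _ (fun m v => is_evpart m -> u m = e (a m (b m v))).
  move=> m; case me : (is_evpart m); last by exists 0.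
  by have /mem_pf_component[v ->] := uM _ me; exists v.
rewrite vP // [a l _](pf_independent actP (@torsion_free _ HF tensor) (H := Hk_group k)
  evpart_shape evpart_rowI (@kappa_evpart_neq0 k) (v := v)) ?linear0 //.
by rewrite -[RHS]u0; apply: eq_bigr => m me; rewrite vP.
Qed.

Lemma pf_component_iso l : is_evpart l -> gl_iso (Wlam F p q l) (pf_component l).
Proof.
move=> le; exists (linfun e); split=> //.
  apply/eqP; rewrite -subv0; apply/subvP => v; rewrite memv_cap memv_ker lfunE /=.
  case/andP=> /mem_Wlam[u ->] /eqP e0; rewrite memv0; apply/eqP.
  exact: (pf_injective actP (@torsion_free _ HF tensor) (H := Hk_group k)
    evpart_shape (@kappa_evpart_neq0 k) le e0).
by move=> i j v _; rewrite !lfunE /= glact_symz.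
Qed.

Lemma semistdP l I : reflect (sst (row_of l) (col_of l) I) (semistd l I).
Proof.
apply: (iffP andP) => -[h1 h2]; split.
- move=> x y r c; have /forallP/(_ y)/implyP := forallP h1 x; apply.
  by rewrite r eqxx c.
- move=> x y c r; have /forallP/(_ y)/implyP := forallP h2 x; apply.
  by rewrite c eqxx r.
- by apply/forallP => x; apply/forallP => y; apply/implyP => /andP[/eqP r c]; exact: h1.
- by apply/forallP => x; apply/forallP => y; apply/implyP => /andP[/eqP c r]; exact: h2.
Qed.

Lemma pf_component_basis l : is_evpart l ->
  basis_of (pf_component l) [seq Pf F l J | J <- enum [pred J : seqT p q n | semistd l J]].
Proof.
move=> le; have sh := evpart_shape le; set X := map _ _.
have fX : free X.
  apply: free_map_enum => c c0.
  apply: (sst_independent HF sh (P := [pred J | semistd l J])) => [J /semistdP//|].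
  have z : e (a l (b l (\sum_(J | [pred J | semistd l J] J) c J *: w J))) = 0.
    rewrite -[RHS]c0 (linear_sum (b l)) (linear_sum (a l)) (linear_sum e).
    by apply: eq_bigr => J _; rewrite !linearZ PfE.
  have {}z := pf_injective actP (@torsion_free _ HF tensor) (H := Hk_group k)
    evpart_shape (@kappa_evpart_neq0 k) le z.
  rewrite -[RHS]z (linear_sum (b l)) (linear_sum (a l)).
  by apply: eq_bigr => J _; rewrite !linearZ.
rewrite /basis_of fX andbT eqEsubv; apply/andP; split.
  by apply/span_subvP => _ /mapP[J _ ->]; apply/mem_pf_component; exists (w J); exact: PfE.
apply/subvP => _ /mem_pf_component[u ->].
(* Straightening is applied to the preimage under e of the span, which reduces to semistandard
   sequences. *)
have st := straighten HF sh (U := (linfun e @^-1: <<X>>)%VS).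
rewrite [u]tensor_basis (linear_sum (b l)) (linear_sum (a l)) (linear_sum e).
apply: memv_suml => I _; rewrite !linearZ rpredZ //=.
have := st _ I; rewrite -memv_preim lfunE; apply=> J /semistdP sJ.
rewrite -memv_preim lfunE /= -PfE; apply: memv_span; apply: map_f.
by rewrite mem_enum.
Qed.

End Plethysm.

Theorem theorem4p4 (F : fieldType) (HF : [pchar F] =i pred0) (p q k : nat) :
  exists M : ptn k.*2 -> {vspace tensorT F p q k.*2},
    [/\ forall l, is_evpart l -> gl_stable (M l),
        (\sum_(l | is_evpart l) M l)%VS = SkS2 F p q k,
        directv (\sum_(l | is_evpart l) M l),
        forall l, is_evpart l -> gl_iso (Wlam F p q l) (M l) &
        forall l, is_evpart l ->
          basis_of (M l) [seq Pf F l J | J <- enum [pred J : seqT p q k.*2 | semistd l J]]].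
Proof.
exists (@pf_component F p q k); split.
- by move=> l _; exact: pf_component_stable.
- exact: pf_components_span.
- exact: pf_components_direct.
- exact: pf_component_iso.
- exact: pf_component_basis.
Qed.
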